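(* Let $p$ be a prime, let $G$ be a finite $p$-solvable group with Sylow $p$-subgroup $P$, and let $\mathcal{F}$ be the (saturated) fusion system on $P$ realized by $G$. Then $|\mathrm{Ind}_{\mathcal{F}}(P)|=k(\mathcal{F})$.
   Context: The fusion system $\mathcal{F}$ on the Sylow $p$-subgroup $P$ of $G$ is the category whose objects are the subgroups of $P$ and whose morphisms $Q\to R$ are the homomorphisms induced by conjugation with elements $g\in G$ that conjugate $Q$ into $R$. Elements $x,y\in P$ are $\mathcal{F}$-conjugate if there is a morphism $f:\langle x\rangle\to P$ in $\mathcal{F}$ with $f(x)=y$ (here: if and only if $x,y$ are conjugate in $G$); $k(\mathcal{F})$ is the number of $\mathcal{F}$-conjugacy classes of $P$. A complex class function of $P$ is $\mathcal{F}$-invariant if it is constant on the $\mathcal{F}$-conjugacy classes of $P$. Characters are complex characters. A (non-zero) $\mathcal{F}$-invariant character of $P$ is indecomposable if it is not the sum of two non-zero $\mathcal{F}$-invariant characters of $P$. $\mathrm{Ind}_{\mathcal{F}}(P)$ denotes the set of all indecomposable $\mathcal{F}$-invariant characters of $P$. *)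

(* Defs.v *)
From mathcomp Require Import all_boot all_order all_algebra all_fingroup.
From mathcomp Require Import all_solvable all_field all_character.

Set Implicit Arguments.
Unset Strict Implicit.
Unset Printing Implicit Defensive.

Import GRing.Theory.
Local Open Scope group_scope.

Definition p_solvable (gT : finGroupType) (p : nat) (G : {group gT}) : bool :=
  [forall U : {group gT}, forall V : {group gT},
     chief_factor G V U ==> p.-group (U / V) || p^'.-group (U / V)].

(* The hom-sets Hom(Q, R) of a category whose objects are groups with elements
   in gT and whose morphisms are maps of the underlying sets. *)
Definition hom_family (gT : finGroupType) : Type :=
  forall Q R : {group gT}, {set {ffun subg_of Q -> subg_of R}}.

(* The objects are the subgroups of P; for Q or R outside P the hom-set is
   empty. An element g induces a map Q -> R only if it conjugates Q into R, as
   R is the codomain of f. *)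
Definition fusion_system (gT : finGroupType) (G P : {group gT}) :
    hom_family gT := fun Q R =>
  [set f : {ffun subg_of Q -> subg_of R} |
     [&& Q \subset P, R \subset P
       & [exists g in G, (Q :^ g \subset R) &&
            [forall u : subg_of Q, sgval (f u) == sgval u ^ g]]]].

Section FusionInvariantCharacters.

Variables (gT : finGroupType) (P : {group gT}) (F : hom_family gT).

Definition fusion_conj : rel gT := fun x y =>
  [exists f in F <[x]>%G P, sgval (f (subg <[x]>%G x)) == y].

Definition fusion_class_number : nat := #|equivalence_partition fusion_conj P|.

Definition fusion_invariant (phi : 'CF(P)) : Prop :=
  {in P &, forall x y, fusion_conj x y -> phi x = phi y}.

(* 0 \is a character holds, hence the explicit nonvanishing condition. *)
Definition fusion_character (chi : 'CF(P)) : Prop :=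
  [/\ chi \is a character, chi != 0%R & fusion_invariant chi].

Definition fusion_indecomposable (chi : 'CF(P)) : Prop :=
  fusion_character chi /\
  ~ (exists phi psi : 'CF(P),
       [/\ fusion_character phi, fusion_character psi & chi = (phi + psi)%R]).

End FusionInvariantCharacters.

(* Main.v *)
From HB Require Import structures.
Require Import Defs.
From mathcomp Require Import all_boot all_order all_algebra all_fingroup.
From mathcomp Require Import all_solvable all_field all_character.

Set Implicit Arguments.
Unset Strict Implicit.
Unset Printing Implicit Defensive.

Import Order.TTheory GRing.Theory Num.Theory.

(** For a finite group [H], let [M(H)] be the additive monoid generated by the
    characters of [H] induced from characters of p-subgroups; it is the image
    of the characters of a Sylow p-subgroup under induction.

    The invariant characters of [P] are dual to [M(G)].  An invariant class
    function [f] of [P] is the restriction of a class function [h] of [G], so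
    by Frobenius reciprocity the multiplicity of [beta] in [f] is the inner
    product of [h] with the character induced by [beta]; hence [f] is a
    character as soon as it pairs with [M(G)] in natural numbers.  Suppose that
    [M(G)] is a free commutative monoid on a linearly independent set [B].
    Every member of [B], being indecomposable in [M(G)], is induced from an
    irreducible character of [P], and so the basis dual to [B] consists of
    invariant characters such that every invariant character is a unique
    combination of them with natural coefficients.  They are therefore the
    indecomposable invariant characters, and their number is the dimension of
    the space of invariant class functions, which is the number of fusion
    classes.

    It remains to show that [M(G)] is free in this sense ([p_separable_basis]),
    by induction on the order of [G].  If [G] is a p-group, then [M(G)] consists
    of all characters.  Otherwise let [K] be generated by the p'-elements of
    [G], and [L] by the p-elements of [K]; then [G / K] is a p-group and [K / L]
    is a nontrivial p'-group.  The group [Y = L P] is proper, so that [M(L)],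
    [M(Y)] and all [M(X)] with [X] inside [Y] have bases.  Clifford's theorem
    and Clifford's correspondence hold for these bases ([over_orbit] and
    [over_induced]); unique decomposition in [M] replaces orthogonality, and
    Mackey's formula shows that [M] is stable under restriction.

    In each [G]-orbit on the basis of [L], choose a member [nu] such that [P]
    contains a Sylow p-subgroup of its stabiliser.  The basis of [M(G)] consists
    of the characters induced from those members of the basis of [M(Y)] that
    lie over [Y]-conjugates of the chosen [nu].  They generate
    ([Ind_near_repr]), because by Clifford's correspondence a member of the
    basis of [M(Y)] is induced from the stabiliser of some [nu'], and this
    stabiliser can be conjugated into that of the chosen [nu] in [Y].  They are
    linearly independent ([near_independent]) by the following argument. Let
    [Psi] be a combination of the selected members of the basis of [M(Y)] that
    induces to zero.  On a coset [y L], this says that the sum of the conjugates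
    of [Psi] by the elements of [K] that centralise [y] modulo [L] vanishes.  Put
    [X = L <[y]>].  Members of the basis of [M(X)] vanish on [y L] unless they
    lie over a constituent fixed by [y], and then this constituent determines
    them up to linear characters of the p-group [X / L].  So those conjugating
    elements that fix the constituent act through a p-group, hence trivially,
    [K / L] being a p'-group.  On the other hand, two distinct [K]-conjugates of
    a constituent are not both [Y]-conjugate to the chosen representative
    ([near_repr_conj_inj]).  Therefore no cancellation is possible, and [Psi]
    vanishes on [y L]. *)

Local Open Scope ring_scope.

(** * Free commutative monoids of vectors *)

Section FreeCones.

Variable vT : vectType algC.
Implicit Types (B : seq vT) (b u v w : vT) (M : vT -> Prop).

(** The sum replaces the position of [b] in [B]; when [B] is free it has at most
    one term, and when [b] is not in [B] it is empty. *)
Definition coef B b v : algC :=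
  \sum_(i < size B | B`_i == b) coord (in_tuple B) i v.

Fact coef_is_linear B b : scalar (coef B b).
Proof.
move=> a u v; rewrite /coef mulr_sumr -big_split /=.
by apply: eq_bigr => i _; rewrite linearP.
Qed.
HB.instance Definition _ B b :=
  GRing.isLinear.Build algC vT algC *%R (coef B b) (coef_is_linear B b).

Lemma coefD B b u v : coef B b (u + v) = coef B b u + coef B b v.
Proof. exact: (linearD (coef B b)). Qed.

Lemma coef0 B b : coef B b 0 = 0.
Proof. exact: (linear0 (coef B b)). Qed.

Lemma coefZ B b a v : coef B b (a *: v) = a * coef B b v.
Proof. exact: (linearZ_LR (coef B b)). Qed.

Lemma coef_big B b (I : Type) (r : seq I) (P : pred I) (F : I -> vT) :
  coef B b (\sum_(i <- r | P i) F i) = \sum_(i <- r | P i) coef B b (F i).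
Proof. exact: (linear_sum (coef B b)). Qed.

Lemma coef_out B b v : b \notin B -> coef B b v = 0.
Proof.
move=> B'b; rewrite /coef big1 // => i /eqP Bi.
by case/negP: B'b; rewrite -Bi mem_nth.
Qed.

Lemma coef_nth B (i : 'I_(size B)) v :
  uniq B -> coef B B`_i v = coord (in_tuple B) i v.
Proof.
move=> uB; rewrite /coef (big_pred1 i) // => j /=.
by rewrite nth_uniq.
Qed.

Lemma coef_expand_span B v :
  free B -> v \in <<B>>%VS -> v = \sum_(b <- B) coef B b v *: b.
Proof.
move=> frB /(coord_span (X := in_tuple B)) {1}->.
rewrite (big_nth (0 : vT)) big_mkord; apply: eq_bigr => i _.
by rewrite coef_nth ?free_uniq.
Qed.

Lemma coef_sum B (c : vT -> algC) b :
  free B -> b \in B -> coef B b (\sum_(v <- B) c v *: v) = c b.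
Proof.
move=> frB Bb; have ltbB: (index b B < size B)%N by rewrite index_mem.
have Db: b = B`_(Ordinal ltbB) by rewrite /= nth_index.
rewrite [in LHS]Db coef_nth ?free_uniq // (big_nth (0 : vT)) big_mkord.
by rewrite (coord_sum_free (fun i : 'I_(size B) => c B`_i)) // -Db.
Qed.

Lemma coef_id B b v : free B -> v \in B -> coef B b v = (v == b)%:R.
Proof.
move=> frB Bv; case Bb: (b \in B); last first.
  by rewrite coef_out ?Bb //; case: eqP => // vb; rewrite -vb Bv in Bb.
have Dv: v = \sum_(u <- B) (v == u)%:R *: u.
  rewrite (bigD1_seq v) ?free_uniq //= eqxx scale1r big1 ?addr0 // => u.
  by rewrite eq_sym => /negPf->; rewrite scale0r.
by rewrite [in LHS]Dv coef_sum.
Qed.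

Definition nat_span B v := exists n : vT -> nat, v = \sum_(b <- B) b *+ n b.

Lemma nat_spanD B u v : nat_span B u -> nat_span B v -> nat_span B (u + v).
Proof.
case=> n -> [m ->]; exists (fun b => n b + m b)%N.
by rewrite -big_split; apply: eq_bigr => b _; rewrite mulrnDr.
Qed.

Lemma nat_span0 B : nat_span B 0.
Proof. by exists (fun _ => 0%N); rewrite big1. Qed.

Lemma nat_span_mem B b : uniq B -> b \in B -> nat_span B b.
Proof.
move=> uB Bb; exists (fun c => c == b : nat).
rewrite (bigD1_seq b) //= eqxx big1 ?addr0 // => c /negPf->.
by rewrite mulr0n.
Qed.

Lemma nat_spanMn B v n : nat_span B v -> nat_span B (v *+ n).
Proof.
move=> Bv; elim: n => [|n IHn]; first exact: nat_span0.
by rewrite mulrS; apply: nat_spanD.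
Qed.

Lemma nat_span_sum B (I : eqType) (r : seq I) (P : pred I) (F : I -> vT) :
  (forall i, i \in r -> P i -> nat_span B (F i)) ->
  nat_span B (\sum_(i <- r | P i) F i).
Proof.
move=> BF; rewrite big_seq_cond; apply: big_ind => [||i /andP[]].
- exact: nat_span0.
- exact: nat_spanD.
exact: BF.
Qed.

Definition indecomposable M u :=
  [/\ M u, u != 0 & forall v w, M v -> M w -> u = v + w -> v = 0 \/ w = 0].

(** [B] is linearly independent over the complex numbers, which is more than free
    generation of the monoid [M]: it makes the coefficients linear forms on the
    whole space. *)
Definition nat_basis M B :=
  [/\ free B, {in B, forall b, M b}
    & forall v, M v -> nat_span B v].

Section NatBasis.

Variables (M : vT -> Prop) (B : seq vT).
Hypotheses (basisB : nat_basis M B) (M0 : M 0).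
Hypothesis MD : forall u v, M u -> M v -> M (u + v).

Let frB : free B. Proof. by case: basisB. Qed.

Lemma nat_basisM b : b \in B -> M b.
Proof. by case: basisB => _ sBM _; apply: sBM. Qed.

Lemma nat_basis_neq0 b : b \in B -> b != 0.
Proof. exact: free_not0. Qed.

Lemma coef_nat b v : M v -> coef B b v \in Num.nat.
Proof.
case: basisB => _ _ genB /genB[n ->].
case Bb: (b \in B); last by rewrite coef_out ?Bb.
under eq_bigr do rewrite -scaler_nat.
by rewrite coef_sum ?natr_nat.
Qed.

Lemma coef_ge0 b v : M v -> 0 <= coef B b v.
Proof. by move/(coef_nat b); apply: natr_ge0. Qed.

Lemma nat_basis_span v : M v -> v \in <<B>>%VS.
Proof.
case: basisB => _ _ genB /genB[n ->]; rewrite big_seq.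
by apply: memv_suml => b Bb; rewrite rpredMn ?memv_span.
Qed.

Lemma coef_expand v : M v -> v = \sum_(b <- B) coef B b v *: b.
Proof. by move/nat_basis_span/(coef_expand_span frB). Qed.

Lemma coef_eq0 v : M v -> (forall b, b \in B -> coef B b v = 0) -> v = 0.
Proof.
move=> Mv v0; rewrite (coef_expand Mv) big_seq big1 // => b /v0->.
by rewrite scale0r.
Qed.

Lemma coef_neq0 v : M v -> v != 0 -> exists2 b, b \in B & coef B b v != 0.
Proof.
move=> Mv nz_v; case: (altP (@hasP _ (fun b => coef B b v != 0) B)) => //.
rewrite -all_predC => /allP v0; case/eqP: nz_v.
by apply: coef_eq0 => // b /v0/=; rewrite negbK => /eqP.
Qed.

Lemma cone_natmul v n : M v -> M (v *+ n).
Proof. by move=> Mv; elim: n => [|n IHn]; rewrite ?mulr0n // mulrS; apply: MD. Qed.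

Lemma cone_sum (I : Type) (r : seq I) (P : pred I) (F : I -> vT) :
  (forall i, P i -> M (F i)) -> M (\sum_(i <- r | P i) F i).
Proof. by move=> MF; apply: big_ind. Qed.

(** Natural coefficients make subtraction of a basis element possible inside
    [M]; this replaces the usual passage to a constituent of a character. *)
Lemma coef_occurs b v : M v -> coef B b v != 0 -> exists2 w, M w & v = b + w.
Proof.
move=> Mv nz_b; have Bb: b \in B by apply: contraNT nz_b => /coef_out->.
have [n Dn] : exists n, coef B b v = n.+1%:R.
  have /natrP[[|n] Dn] := coef_nat b Mv; last by exists n.
  by rewrite Dn eqxx in nz_b.
have uB := free_uniq frB.
exists (b *+ n + \sum_(c <- B | c != b) coef B c v *: c).
  apply: MD; first by apply: cone_natmul; apply: nat_basisM.
  rewrite big_seq_cond; apply: cone_sum => c /andP[Bc _].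
  have /natrP[m ->] := coef_nat c Mv.
  by rewrite scaler_nat; apply: cone_natmul; apply: nat_basisM.
rewrite {1}(coef_expand Mv) (bigD1_seq b) //= Dn scaler_nat mulrS.
by rewrite addrA.
Qed.

(** A basis is determined by the monoid, hence stable under its automorphisms. *)
Lemma nat_basis_mem u : u \in B <-> indecomposable M u.
Proof.
split=> [Bu | [Mu nz_u ind_u]].
  split=> [||v w Mv Mw Duvw]; [exact: nat_basisM | exact: nat_basis_neq0 |].
  have Euvw b: coef B b v + coef B b w = (u == b)%:R.
    by rewrite -coefD -Duvw coef_id.
  have z b : b != u -> coef B b v = 0 /\ coef B b w = 0.
    move=> neq_bu; have /eqP := Euvw b; rewrite (eq_sym u) (negPf neq_bu).
    by rewrite paddr_eq0 ?coef_ge0 // => /andP[/eqP-> /eqP->].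
  have /natrP[n Dn] := coef_nat u Mv; have /natrP[m Dm] := coef_nat u Mw.
  have := Euvw u; rewrite eqxx Dn Dm -natrD => /eqP; rewrite eqr_nat.
  case: n Dn => [|n] Dn.
    left; apply: coef_eq0 => // b Bb.
    by have [-> | /z[]] := eqVneq b u.
  case: m Dm => [|m] Dm; last by rewrite addSn addnS.
  right; apply: coef_eq0 => // b Bb.
  by have [-> | /z[]] := eqVneq b u.
have [b Bb /(coef_occurs Mu)[w Mw Du]] := coef_neq0 Mu nz_u.
case: (ind_u b w) => // [|b0 | w0]; first exact: nat_basisM.
  by have := nat_basis_neq0 Bb; rewrite b0 eqxx.
by rewrite Du w0 addr0.
Qed.

End NatBasis.

End FreeCones.

Lemma free_map_linear (vT wT : vectType algC) (f : {linear vT -> wT}) (F : seq vT) :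
    free F -> (forall v, v \in <<F>>%VS -> f v = 0 -> v = 0) ->
  free (map f F).
Proof.
move=> frF injf; apply/(@freeP _ _ _ (map_tuple f (in_tuple F))) => k kF0.
apply: (@freeP _ _ _ (in_tuple F) frF); apply: injf.
  by apply: memv_suml => i _; rewrite memvZ // memv_span ?mem_nth.
rewrite linear_sum -[RHS]kF0; apply: eq_bigr => i _.
by rewrite linearZ /= (nth_map (0 : vT)).
Qed.
Local Open Scope group_scope.
Local Open Scope ring_scope.

(** * Conjugation, induction and restriction *)

Section Transport.

Variable gT : finGroupType.
Implicit Types (D G H J : {group gT}) (x g : gT).

Definition cfJ H x (phi : 'CF(H)) : 'CF((H :^ x)%G) :=
  cfIsom (conj_isom H x) phi.

Lemma cfJE H x (phi : 'CF(H)) u : cfJ x phi u = phi (u ^ x^-1)%g.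
Proof.
case Hu: (u ^ x^-1 \in H)%g; last first.
  by rewrite !cfun0 ?mem_conjg ?Hu.
by rewrite -{1}(conjgKV x u) /cfJ cfIsomE.
Qed.

Lemma cfJ_char H x (chi : 'CF(H)) :
  (cfJ x chi \is a character) = (chi \is a character).
Proof. exact: cfIsom_char. Qed.

Lemma cfInd_cfJ G H g (phi : 'CF(H)) :
  H \subset G -> g \in G -> 'Ind[G] (cfJ g phi) = 'Ind[G] phi.
Proof.
move=> sHG Gg; have sHgG: H :^ g \subset G by rewrite conj_subG.
apply/cfunP=> u; rewrite !cfIndE //= cardJg; congr (_ * _).
rewrite (reindex_inj (mulIg g)); apply: eq_big => [y|y _]; first exact: groupMr.
by rewrite cfJE conjgM conjgK.
Qed.

Lemma cfJ_Ind D H g (phi : 'CF(D)) :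
  D \subset H -> cfJ g ('Ind[H] phi) = 'Ind[(H :^ g)%G] (cfJ g phi).
Proof.
move=> sDH; apply/cfunP=> u.
rewrite cfJE !cfIndE ?conjSg //= cardJg; congr (_ * _).
rewrite [RHS](reindex_inj (conjg_inj g)).
apply: eq_big => [y|y _]; first by rewrite memJ_conjg.
by rewrite cfJE -[in RHS](conjgKV g u) -conjJg conjgK.
Qed.

(** Each element of [J * H] arises from [#|J :&: H|] pairs; averaging over left
    translations by [J] avoids counting them. *)
Lemma sum_mulG J H (F : gT -> algC) :
    {in H, forall h x, F (x * h)%g = F x} ->
  \sum_(x in (J * H)%g) F x = #|H|%:R / #|J :&: H|%:R * \sum_(x in J) F x.
Proof.
move=> FH; have nzJ := neq0CG J; set S := (J * H)%g.
have nzI: #|J :&: H|%:R != 0 :> algC := neq0CG _.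
have <-: #|S|%:R / #|J|%:R = #|H|%:R / #|J :&: H|%:R :> algC.
  by apply/eqP; rewrite eqr_div // -!natrM -mul_cardG mulnC.
have FJ x: x \in S -> \sum_(y in J) F (y * x)%g = \sum_(y in J) F y.
  case/mulsgP=> j h Jj Hh ->; rewrite [RHS](reindex_inj (mulIg j)).
  by apply: eq_big => [y|y _]; rewrite ?groupMr // mulgA FH.
rewrite mulrAC; apply: canRL (mulfK nzJ) _.
rewrite mulr_natr -sumr_const mulr_natl -sumr_const.
rewrite -(eq_bigr _ FJ) [RHS]exchange_big /=; apply: eq_bigr => y Jy.
rewrite (reindex_inj (mulgI y)) /=; apply: eq_bigl => x.
apply/mulsgP/mulsgP=> [] [j h Jj Hh Dx].
  by exists (y^-1 * j)%g h; rewrite ?groupM ?groupV // -mulgA -Dx mulKg.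
by exists (y * j)%g h; rewrite ?groupM // Dx mulgA.
Qed.

Definition double_coset J D x : {set gT} := (J :* x * D)%g.

Lemma double_coset_refl J D x : x \in double_coset J D x.
Proof. by apply/mulsgP; exists x 1%g; rewrite ?rcoset_refl ?mulg1. Qed.

Lemma double_coset_eqP J D x y :
  reflect (double_coset J D y = double_coset J D x) (y \in double_coset J D x).
Proof.
apply: (iffP idP) => [|<-]; last exact: double_coset_refl.
case/mulsgP=> _ d /rcosetP[j Jj ->] Dd ->.
by rewrite /double_coset !rcosetM (rcoset_id Jj) -mulgA (lcoset_id Dd).
Qed.

Definition mackey_term J D g (delta : 'CF(D)) : 'CF(J) :=
  'Ind[J] ('Res[(J :&: D :^ g^-1)%G] (cfJ g^-1 delta)).

Lemma mackey_termE J D g (delta : 'CF(D)) u : u \in J ->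
  mackey_term J g delta u
    = #|J :&: D :^ g^-1|%:R^-1 * \sum_(x in J) delta (u ^ (x * g))%g.
Proof.
move=> Ju; rewrite /mackey_term cfIndE ?subsetIl //=; congr (_ * _).
apply: eq_bigr => x Jx; have Jux : (u ^ x)%g \in J by rewrite groupJ.
case Eux: ((u ^ x)%g \in (J :&: D :^ g^-1)%G).
  by rewrite cfResE ?subsetIr // cfJE invgK conjgM.
rewrite !cfun0 ?Eux //; move: Eux; rewrite /= inE Jux /= mem_conjg invgK conjgM.
by move->.
Qed.

(** Mackey's formula: the defining sum of the induced function is split along
    the double cosets, and [sum_mulG] evaluates each part. *)
Lemma cfRes_Ind_Mackey H J D (delta : 'CF(D)) :
    J \subset H -> D \subset H ->
  'Res[J] ('Ind[H] delta)
    = \sum_(C in [set double_coset J D x | x in H]) mackey_term J (repr C) delta.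
Proof.
move=> sJH sDH; apply/cfun_inP=> u Ju; rewrite cfResE // cfIndE // sum_cfunE.
rewrite (partition_big_imset (double_coset J D)) mulr_sumr /=.
apply: eq_bigr => C /imsetP[x0 Hx0 DC]; rewrite mackey_termE //.
have sCH: C \subset H.
  by rewrite DC !mul_subG ?sub1set.
set g := repr C; have Cg: g \in C.
  by apply: (mem_repr x0); rewrite DC double_coset_refl.
have{x0 Hx0} DC : C = double_coset J D g.
  by rewrite DC; apply/esym/double_coset_eqP; rewrite -DC.
have Hg : g \in H := subsetP sCH g Cg.
have memC h : (h \in H) && (double_coset J D h == C) = (h \in C).
  apply/andP/idP => [[_ /eqP <-] | Ch]; first exact: double_coset_refl.
  by rewrite (subsetP sCH) // {1}DC; split=> //; apply/eqP/double_coset_eqP; rewrite -DC.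
rewrite (eq_bigl _ _ memC) (reindex_inj (mulIg g)) /=.
rewrite (eq_bigl (mem (J * D :^ g^-1)%g)) => [|x]; last first.
  have ->: C = (J * D :^ g^-1 :* g)%g.
    by rewrite {1}DC conjsgE invgK !mulgA -[RHS]mulgA mulg_set1 mulVg mulg1.
  by rewrite mem_rcoset mulgK.
rewrite (@sum_mulG J (D :^ g^-1)%G) ?cardJg => [|d Dd x].
  by rewrite mulrA mulrA mulVf ?neq0CG // mul1r.
move: Dd; rewrite mem_conjg invgK => Dgd.
by rewrite -mulgA (conjgC d) mulgA conjgM cfunJ.
Qed.

End Transport.

(** * Characters induced from p-subgroups *)

Section InducedMonoid.

Variables (gT : finGroupType) (p : nat).
Implicit Types (D G H J L P T : {group gT}) (x g : gT).

(** The monoid [M(H)].  The generators range over all p-subgroups rather than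
    over the subgroups of a fixed Sylow subgroup, so that stability under
    conjugation, induction and restriction can be checked on generators. *)
Inductive p_induced H : 'CF(H) -> Prop :=
| p_induced_zero : p_induced 0
| p_induced_step D (delta : 'CF(D)) Phi of D \subset H & p.-group D
    & delta \is a character & p_induced Phi : p_induced ('Ind[H] delta + Phi).

Lemma p_induced_Ind_char H D (delta : 'CF(D)) :
    D \subset H -> p.-group D -> delta \is a character ->
  p_induced ('Ind[H] delta).
Proof.
move=> sDH pD Nd; rewrite -[X in p_induced X]addr0.
exact: p_induced_step (p_induced_zero _).
Qed.

Lemma p_inducedD H (Phi Psi : 'CF(H)) :
  p_induced Phi -> p_induced Psi -> p_induced (Phi + Psi).
Proof.
elim=> [|D delta Theta sDH pD Nd _ IH] Psi_p; first by rewrite add0r.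
by rewrite -addrA; apply: p_induced_step (IH Psi_p).
Qed.

Lemma p_induced_sum H (I : Type) (r : seq I) (P : pred I) (F : I -> 'CF(H)) :
  (forall i, P i -> p_induced (F i)) -> p_induced (\sum_(i <- r | P i) F i).
Proof.
by move=> MF; apply: big_ind => //; [apply: p_induced_zero | apply: p_inducedD].
Qed.

Lemma p_induced_char H (Phi : 'CF(H)) : p_induced Phi -> Phi \is a character.
Proof.
elim=> [|D delta Theta sDH pD Nd _ NTheta]; first exact: cfun0_char.
by rewrite rpredD ?cfInd_char.
Qed.

Lemma p_induced_eq0 H (Phi : 'CF(H)) : p_induced Phi -> Phi 1%g = 0 -> Phi = 0.
Proof. by move/p_induced_char/char1_eq0 => E /eqP; rewrite E => /eqP. Qed.

Lemma p_induced_p_elt H (Phi : 'CF(H)) u :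
  p_induced Phi -> ~~ p.-elt u -> Phi u = 0.
Proof.
move=> Phi_p p'u; elim: Phi_p => [|D delta Theta sDH pD _ _]; rewrite cfunE //.
move->; rewrite addr0 cfIndE // big1 ?mulr0 // => y Hy; apply: cfun0.
by apply: contra p'u => /(mem_p_elt pD); rewrite p_eltJ.
Qed.

Lemma p_induced_Ind G H (Phi : 'CF(H)) :
  H \subset G -> p_induced Phi -> p_induced ('Ind[G] Phi).
Proof.
move=> sHG; elim=> [|D delta Theta sDH pD Nd _ IH].
  by rewrite linear0; apply: p_induced_zero.
by rewrite linearD /= cfIndInd //; apply: p_induced_step; rewrite ?(subset_trans sDH).
Qed.

Lemma p_induced_mackey_term H D g (delta : 'CF(D)) :
  p.-group D -> delta \is a character -> p_induced (mackey_term H g delta).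
Proof.
move=> pD Nd; apply: p_induced_Ind_char; first exact: subsetIl.
  by apply: pgroupS (subsetIr _ _) _; rewrite pgroupJ.
by rewrite cfRes_char ?cfJ_char.
Qed.

Lemma p_induced_Res H J (Phi : 'CF(H)) :
  J \subset H -> p_induced Phi -> p_induced ('Res[J] Phi).
Proof.
move=> sJH; elim=> [|D delta Theta sDH pD Nd _ IH].
  by rewrite linear0; apply: p_induced_zero.
rewrite linearD; apply: p_inducedD => //=; rewrite cfRes_Ind_Mackey //.
by apply: p_induced_sum => C _; apply: p_induced_mackey_term.
Qed.

(** The trivial double coset contributes [Phi] to Mackey's formula. *)
Lemma p_induced_Res_Ind H J (Phi : 'CF(J)) : J \subset H -> p_induced Phi ->
  exists2 Psi, p_induced Psi & 'Res[J] ('Ind[H] Phi) = Phi + Psi.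
Proof.
move=> sJH; elim=> [|D delta Theta sDJ pD Nd _ [Psi Psi_p DTheta]].
  by exists 0; [apply: p_induced_zero | rewrite !linear0 addr0].
rewrite !linearD /= cfIndInd // DTheta cfRes_Ind_Mackey ?(subset_trans sDJ) //=.
rewrite (bigD1 (double_coset J D 1)) ?imset_f //=; set W := \sum_(C in _ | _) _.
have W_p: p_induced W by apply: p_induced_sum => C _; apply: p_induced_mackey_term.
exists (W + Psi); first exact: p_inducedD.
rewrite addrACA; congr (_ + _ + _); set g := repr _.
have Jg: g \in J.
  have: g \in double_coset J D 1 by exact: mem_repr (double_coset_refl _ _ _).
  by rewrite /double_coset mulg1 mulGSid.
rewrite /mackey_term; have sDgJ: D :^ g^-1 \subset J by rewrite conj_subG ?groupV.
have ->: (J :&: D :^ g^-1 = D :^ g^-1)%G by apply/val_inj/setIidPr.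
by rewrite cfRes_id cfInd_cfJ ?groupV.
Qed.

Lemma p_induced_mul H (Phi psi : 'CF(H)) :
  p_induced Phi -> psi \is a character -> p_induced (Phi * psi).
Proof.
move=> Phi_p Npsi; elim: Phi_p => [|D delta Theta sDH pD Nd _ IH].
  by rewrite mul0r; apply: p_induced_zero.
rewrite mulrDl -cfIndM //; apply: p_induced_step => //.
by rewrite rpredM ?cfRes_char.
Qed.

(** Inducing the restriction amounts to multiplying by the permutation character
    on [J]-cosets, which contains the trivial character. *)
Lemma p_induced_Ind_Res H J (Phi : 'CF(H)) : J \subset H -> p_induced Phi ->
  exists2 Psi, p_induced Psi & 'Ind[H] ('Res[J] Phi) = Phi + Psi.
Proof.
move=> sJH Phi_p; rewrite -['Res _]mul1r cfIndM //.
have N1: 'Ind[H, J] 1 \is a character by rewrite cfInd_char ?cfun1_char.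
have: 0 \in irr_constt ('Ind[H, J] 1).
  rewrite irr_consttE irr0 -cfdot_Res_r ?rmorph1 cfnorm1 oner_eq0 //.
case/(constt_charP _ N1)=> psi Npsi ->.
exists (Phi * psi); first exact: p_induced_mul.
by rewrite mulrC irr0 mulrDr mulr1.
Qed.

Lemma p_induced_cfJ H g (Phi : 'CF(H)) : p_induced Phi -> p_induced (cfJ g Phi).
Proof.
elim=> [|D delta Theta sDH pD Nd _ IH].
  by rewrite /cfJ linear0; apply: p_induced_zero.
rewrite /cfJ linearD /= -!/(cfJ _ _) cfJ_Ind //.
by apply: p_induced_step; rewrite ?conjSg ?pgroupJ ?cfJ_char.
Qed.

Lemma p_induced_conjg H g (Phi : 'CF(H)) : p_induced Phi -> p_induced (Phi ^ g)%CF.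
Proof.
have [nHg | /cfConjgEout-> //] := boolP (g \in 'N(H)).
elim=> [|D delta Theta sDH pD Nd _ IH].
  by rewrite linear0; apply: p_induced_zero.
rewrite linearD /=.
suff ->: ('Ind[H] delta ^ g)%CF = 'Ind[H] (cfJ g delta).
  by apply: p_induced_step; rewrite ?pgroupJ ?cfJ_char // -(normP nHg) conjSg.
apply/cfunP=> u; rewrite cfConjgE // -cfJE cfJ_Ind //.
have -> : (H :^ g = H)%G by apply/val_inj/normP.
by [].
Qed.

Lemma p_induced_Sylow H P (Phi : 'CF(H)) : p.-Sylow(H) P -> p_induced Phi ->
  exists2 beta : 'CF(P), beta \is a character & Phi = 'Ind[H] beta.
Proof.
move=> sylP; have sPH := pHall_sub sylP.
elim=> [|D delta Theta sDH pD Nd _ [beta Nb ->]].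
  by exists 0; rewrite ?linear0 ?cfun0_char.
have [g Hg sDgP] := Sylow_Jsub sylP sDH pD.
exists ('Ind[P] (cfJ g delta) + beta).
  by rewrite rpredD ?cfInd_char ?cfJ_char.
by rewrite linearD /= cfIndInd // cfInd_cfJ.
Qed.

End InducedMonoid.
Local Open Scope group_scope.
Local Open Scope ring_scope.

(** * Clifford theory for bases of induced characters *)

Section Clifford.

Variables (gT : finGroupType) (p : nat).
Implicit Types (D G H J L P T : {group gT}) (x g h : gT).

Definition pbasis H (B : seq 'CF(H)) := nat_basis (@p_induced gT p H) B.

Section Basis.

Variables (H : {group gT}) (B : seq 'CF(H)).
Hypothesis basisB : pbasis B.

Let H0 := p_induced_zero p H.
Let HD := @p_inducedD gT p H.

Lemma pbasis_pmon b : b \in B -> p_induced p b.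
Proof. exact: nat_basisM basisB _. Qed.

Lemma pbasis_free : free B. Proof. by case: basisB. Qed.

Lemma pbasis_span Phi : p_induced p Phi -> Phi \in <<B>>%VS.
Proof. exact: (nat_basis_span basisB). Qed.

Lemma pbasis_expand Phi : p_induced p Phi -> Phi = \sum_(b <- B) coef B b Phi *: b.
Proof. exact: (coef_expand basisB). Qed.

Lemma pbasis_nat b Phi : p_induced p Phi -> coef B b Phi \in Num.nat.
Proof. exact: (coef_nat basisB). Qed.

Lemma pbasis_ge0 b Phi : p_induced p Phi -> 0 <= coef B b Phi.
Proof. exact: (coef_ge0 basisB). Qed.

Lemma pbasis_occurs b Phi : p_induced p Phi -> coef B b Phi != 0 ->
  exists2 Psi, p_induced p Psi & Phi = b + Psi.
Proof. exact: (coef_occurs basisB H0 HD). Qed.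

(** An additive automorphism of the monoid permutes its indecomposable elements. *)
Lemma pbasis_auto (f : 'CF(H) -> 'CF(H)) b :
    additive f -> bijective f ->
    (forall Phi, p_induced p Phi <-> p_induced p (f Phi)) ->
  b \in B -> f b \in B.
Proof.
move=> fB [f' fK f'K] fP.
have f0: f 0 = 0 by have := fB 0 0; rewrite !subrr.
have f'_p Phi : p_induced p Phi -> p_induced p (f' Phi).
  by move=> Phi_p; apply/fP; rewrite f'K.
case/(nat_basis_mem basisB H0 HD)=> b_p nz_b ind_b.
apply/(nat_basis_mem basisB H0 HD).
split=> [||v w v_p w_p Dfb]; first exact: (fP b).1.
  by apply: contraNneq nz_b => fb0; apply/eqP/(can_inj fK); rewrite fb0 f0.
have fD u v' : f (u + v') = f u + f v'.
  have fN t : f (- t) = - f t by rewrite -sub0r fB f0 sub0r.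
  by rewrite -[v' in LHS]opprK fB fN opprK.
case: (ind_b (f' v) (f' w)) => [||| fv0 | fw0]; auto.
- by apply: (can_inj fK); rewrite fD !f'K.
- by left; rewrite -(f'K v) fv0 f0.
- by right; rewrite -(f'K w) fw0 f0.
Qed.

Lemma pbasis_conjg b g : b \in B -> (b ^ g)%CF \in B.
Proof.
apply: pbasis_auto => [u v||Phi]; first exact: raddfB.
  by exists (cfConjg g^-1); [apply: cfConjgK | apply: cfConjgKV].
split=> [|Phi_p]; first exact: p_induced_conjg.
by rewrite -(cfConjgK g Phi); apply: p_induced_conjg.
Qed.

Lemma pbasis_mul_lin b (lambda : 'CF(H)) :
  lambda \is a linear_char -> b \in B -> b * lambda \in B.
Proof.
move=> Llambda; have Ulambda := lin_char_unitr Llambda.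
apply: (pbasis_auto (f := fun b => b * lambda)) => [u v||Phi].
- exact: mulrBl.
- by exists ( *%R^~ lambda^-1) => b'; rewrite ?mulrK ?mulrVK.
split=> [|Phi_p]; first by move/p_induced_mul; apply; apply: lin_charW.
rewrite -[Phi](mulrK Ulambda); apply: p_induced_mul => //.
by rewrite invr_lin_char // cfConjC_char lin_charW.
Qed.

Lemma coef_conjg b Phi g :
  Phi \in <<B>>%VS -> coef B (b ^ g)%CF (Phi ^ g)%CF = coef B b Phi.
Proof.
have frB := pbasis_free; move/(coef_expand_span frB)->.
rewrite linear_sum !coef_big; apply: eq_big_seq => b' Bb'.
rewrite linearZ /= !coefZ; congr (_ * _).
by rewrite !coef_id ?pbasis_conjg // (can_eq (cfConjgK g)).
Qed.

End Basis.

Section OverNormal.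

Variables (L : {group gT}) (BL : seq 'CF(L)).
Hypothesis basisL : pbasis BL.


(** [nu] is a constituent of the restriction of [Phi] to [L], with respect to the
    basis of [L]. *)
Definition over H (Phi : 'CF(H)) nu := coef BL nu ('Res[L] Phi) != 0.

Lemma over_mem H (Phi : 'CF(H)) nu : over Phi nu -> nu \in BL.
Proof. by apply: contraNT => /coef_out->. Qed.

Lemma cfRes_Ind_conjg H T (Phi : 'CF(T)) nu c :
    L <| H -> L \subset T -> T \subset H -> 'Res[L] Phi = c *: nu ->
  'Res[L] ('Ind[H] Phi) = (c / #|T|%:R) *: \sum_(h in H) (nu ^ h)%CF.
Proof.
case/andP=> sLH nLH sLT sTH DPhi; apply/cfun_inP=> u Lu.
rewrite cfResE // cfIndE // cfunE sum_cfunE mulrC mulr_suml mulr_sumr.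
rewrite [RHS](reindex_inj invg_inj) /=.
apply: eq_big => [h|h Hh]; first by rewrite groupV.
have nLh: h \in 'N(L) by apply: (subsetP nLH).
rewrite cfConjgE ?groupV // invgK [RHS]mulrAC; congr (_ / _).
by rewrite -(cfResE Phi sLT) ?memJ_norm // DPhi cfunE.
Qed.

Variables (H : {group gT}) (BH : seq 'CF(H)).
Hypotheses (nsLH : L <| H) (basisH : pbasis BH).

Let H0 := p_induced_zero p H.
Let HD := @p_inducedD gT p H.
Let sLH : L \subset H := normal_sub nsLH.
Let nLH h : h \in H -> h \in 'N(L).
Proof. exact: (subsetP (normal_norm nsLH)). Qed.

Lemma over_conjg Phi nu h : p_induced p Phi -> h \in H ->
  over Phi (nu ^ h)%CF = over (Phi : 'CF(H)) nu.
Proof.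
move=> Phi_p Hh; rewrite /over -{1}(cfConjg_id Phi Hh).
rewrite -(cfConjgRes _ (normal_refl H)) // coef_conjg //.
by apply: (pbasis_span basisL); apply: p_induced_Res.
Qed.

Lemma over_ex Phi : p_induced p Phi -> Phi != 0 -> exists nu, over (Phi : 'CF(H)) nu.
Proof.
move=> Phi_p nzPhi; have RPhi_p := p_induced_Res sLH Phi_p.
case: (coef_neq0 basisL RPhi_p) => [|nu _ nu_Phi]; last by exists nu.
apply: contra nzPhi => /eqP R0; apply/eqP/(p_induced_eq0 Phi_p).
by rewrite -(cfRes1 L) R0 cfunE.
Qed.

Lemma over_add Phi Psi nu : p_induced p Phi -> p_induced p Psi ->
  over (Phi + Psi : 'CF(H)) nu = over Phi nu || over Psi nu.
Proof.
move=> Phi_p Psi_p; rewrite /over linearD /= coefD paddr_eq0 ?negb_and //.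
  by apply: (pbasis_ge0 basisL); apply: p_induced_Res.
by apply: (pbasis_ge0 basisL); apply: p_induced_Res.
Qed.

(** If [Phi] restricts to a multiple of [nu], the induced function restricts to a
    multiple of the sum of the [H]-orbit of [nu]. *)
Lemma over_Ind T (Phi : 'CF(T)) nu nu' c :
    nu \in BL -> L \subset T -> T \subset H -> 'Res[L] Phi = c *: nu ->
  over ('Ind[H] Phi) nu' -> exists2 h, h \in H & nu' = (nu ^ h)%CF.
Proof.
move=> BLnu sLT sTH DPhi; rewrite /over (cfRes_Ind_conjg nsLH sLT sTH DPhi).
case: (altP (@exists_inP _ (mem H) (fun h => nu' == (nu ^ h)%CF))).
  by case=> h Hh /eqP-> _; exists h.
rewrite negb_exists_in => /forall_inP no_h; rewrite coefZ coef_big big1 ?mulr0 ?eqxx //.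
move=> h Hh; rewrite coef_id ?pbasis_conjg ?(pbasis_free basisL) //.
by rewrite eq_sym (negPf (no_h h Hh)).
Qed.

Lemma p_induced_Ind_sub nu : nu \in BL -> p_induced p ('Ind[H] nu).
Proof. by move=> BLnu; apply: p_induced_Ind => //; apply: pbasis_pmon BLnu. Qed.

Lemma constituent_over b nu nu' : b \in BH -> nu \in BL ->
    coef BH b ('Ind[H] nu) != 0 -> over b nu' ->
  exists2 h, h \in H & nu' = (nu ^ h)%CF.
Proof.
move=> BHb BLnu b_nu over_b; have Inu_p := p_induced_Ind_sub BLnu.
have [W W_p DInu] := pbasis_occurs basisH Inu_p b_nu.
apply: (@over_Ind L nu nu nu' 1) => //; first by rewrite cfRes_id scale1r.
rewrite DInu over_add ?over_b //.
exact: pbasis_pmon BHb.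
Qed.

Lemma cfInd_conjg nu h : h \in H -> 'Ind[H] (nu ^ h)%CF = 'Ind[H, L] nu.
Proof. by move=> Hh; rewrite -(cfConjgInd _ (normal_refl H)) // cfConjg_id. Qed.

(** A substitute for Frobenius reciprocity, which is not available as basis
    elements are not orthonormal: [b] occurs in the function induced from its
    restriction to [L], hence in some ['Ind[H] nu0] with [nu0] below [b]; and
    [nu] is conjugate to [nu0]. *)
Lemma over_constituent b nu : b \in BH -> over b nu -> coef BH b ('Ind[H] nu) != 0.
Proof.
move=> BHb over_b; have b_p := pbasis_pmon basisH BHb.
have [W W_p DIR] := p_induced_Ind_Res sLH b_p.
have RB := pbasis_expand basisL (p_induced_Res sLH b_p).
have [nu0 BLnu0 /andP[over0 b_nu0]] : exists2 nu0, nu0 \in BL &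
  over b nu0 && (coef BH b ('Ind[H] nu0) != 0).
- apply/hasP; apply: contraTT isT => /hasPn no_nu.
  have: coef BH b ('Ind[H] ('Res[L] b)) == 0.
    rewrite RB linear_sum coef_big big_seq big1 // => nu1 BLnu1.
    rewrite linearZ /= coefZ; apply/eqP; rewrite mulf_eq0.
    by have:= no_nu _ BLnu1; rewrite negb_and !negbK.
  rewrite DIR coefD paddr_eq0 ?(pbasis_ge0 basisH) //.
  by rewrite coef_id ?(pbasis_free basisH) // eqxx oner_eq0.
have [h Hh ->] := constituent_over BHb BLnu0 b_nu0 over_b.
by rewrite cfInd_conjg.
Qed.

(** Clifford's theorem: [b] occurs in a function induced from [L], whose
    restriction to [L] is supported on one orbit. *)
Lemma over_orbit b nu nu' : b \in BH -> over b nu -> over b nu' ->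
  exists2 h, h \in H & nu' = (nu ^ h)%CF.
Proof.
move=> BHb over_b; apply: constituent_over (over_constituent BHb over_b) => //.
exact: over_mem over_b.
Qed.

Lemma constituent_overP b nu : b \in BH -> nu \in BL ->
  coef BH b ('Ind[H] nu) != 0 -> over b nu.
Proof.
move=> BHb BLnu b_nu; have b_p := pbasis_pmon basisH BHb.
have [nu' over_b] := over_ex b_p (nat_basis_neq0 basisH BHb).
have [h Hh Dnu'] := constituent_over BHb BLnu b_nu over_b.
by rewrite -(over_conjg nu b_p Hh) -Dnu'.
Qed.

Lemma cfRes_over_inv b nu : b \in BH -> over b nu -> H \subset 'I[nu] ->
  'Res[L] b = coef BL nu ('Res[L] b) *: nu.
Proof.
move=> BHb over_b Inu; have b_p := pbasis_pmon basisH BHb.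
rewrite {1}(pbasis_expand basisL (p_induced_Res sLH b_p)).
rewrite (bigD1_seq nu) ?(over_mem over_b) ?free_uniq ?(pbasis_free basisL) //=.
rewrite big1 ?addr0 // => nu' neq_nu'.
have [-> | over_b'] := eqVneq (coef BL nu' ('Res[L] b)) 0; first exact: scale0r.
have [h Hh Dnu'] := over_orbit BHb over_b over_b'.
by case/eqP: neq_nu'; rewrite Dnu' inertiaJ ?(subsetP Inu).
Qed.

End OverNormal.

End Clifford.
Local Open Scope group_scope.
Local Open Scope ring_scope.

Section CliffordCorrespondence.

Variables (gT : finGroupType) (p : nat).
Variables (L H : {group gT}) (BL : seq 'CF(L)) (BH : seq 'CF(H)).
Hypotheses (nsLH : L <| H) (basisL : pbasis p BL) (basisH : pbasis p BH).

Let sLH : L \subset H := normal_sub nsLH.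

(** Clifford's correspondence.  Some [b'] in the basis of the stabiliser [T] lies
    over [nu] and induces to [b + W].  By Mackey's formula [b'] occurs in the
    restriction to [T] of [b] or of [W].  Either of them then accounts for the
    full multiplicity of [nu] in the restriction of [b + W] to [L], and the other
    one, having no constituent in the orbit of [nu], is zero. *)
Lemma over_induced b nu (BT : seq 'CF('I_H[nu])) :
    pbasis p BT -> b \in BH -> over BL b nu ->
  exists b' c,
    [/\ p_induced p b', 'Res[L] b' = c *: nu & b = 'Ind[H, 'I_H[nu]] b'].
Proof.
move=> basisT BHb over_b; set T := ('I_H[nu])%G in BT basisT *.
have sTH: T \subset H := Inertia_sub _ _.
have nsLT: L <| T := normal_Inertia _ sLH.
have sLT := normal_sub nsLT; have Inu: T \subset 'I[nu] := subsetIr _ _.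
have BLnu := over_mem over_b; have nu_p := pbasis_pmon basisL BLnu.
have [b' BTb' /andP[b'_nu b_b']] : exists2 b', b' \in BT &
  (coef BT b' ('Ind[T] nu) != 0) && (coef BH b ('Ind[H] b') != 0).
- apply/hasP; apply: contraTT isT => /hasPn no_b'.
  have /eqP[] := over_constituent basisL nsLH basisH BHb over_b.
  rewrite -(cfIndInd _ sTH sLT) (pbasis_expand basisT (p_induced_Ind sLT nu_p)).
  rewrite linear_sum coef_big big_seq big1 // => b' /no_b'.
  by rewrite linearZ /= coefZ negb_and !negbK -mulf_eq0 => /eqP.
have b'_p := pbasis_pmon basisT BTb'.
have over_b' := constituent_overP basisL nsLT basisT BTb' BLnu b'_nu.
have := cfRes_over_inv basisL nsLT basisT BTb' over_b' Inu.
set e := coef _ _ _ => Rb'; have nz_e : e != 0 := over_b'.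
exists b', e; split=> //.
have Phi_p: p_induced p ('Ind[H] b') := p_induced_Ind sTH b'_p.
have [W W_p DPhi] := pbasis_occurs basisH Phi_p b_b'.
have b_p := pbasis_pmon basisH BHb.
have RPhi: coef BL nu ('Res[L] ('Ind[H] b')) = e.
  rewrite (cfRes_Ind_conjg nsLH sLT sTH Rb') coefZ coef_big.
  have ->: \sum_(h in H) coef BL nu (nu ^ h)%CF = #|T|%:R.
    rewrite -sumr_const.
    rewrite [RHS](eq_bigl (fun h => (h \in H) && (h \in 'I[nu]))) => [|h]; last first.
      by rewrite /T /= inE.
    rewrite big_mkcondr /=; apply: eq_bigr => h Hh.
    rewrite coef_id ?(pbasis_conjg basisL) ?(pbasis_free basisL) // inE.
    by rewrite (subsetP (normal_norm nsLH)) //=; case: eqP.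
  by rewrite divfK ?neq0CG.
have le_e (Psi : 'CF(H)) : p_induced p Psi -> coef BT b' ('Res[T] Psi) != 0 ->
  e <= coef BL nu ('Res[L] Psi).
- move=> Psi_p b'_Psi; rewrite -(cfResRes _ sLT sTH).
  have [V V_p ->] := pbasis_occurs basisT (p_induced_Res sTH Psi_p) b'_Psi.
  rewrite linearD /= Rb' coefD coefZ coef_id ?(pbasis_free basisL) // eqxx mulr1.
  by rewrite lerDl (pbasis_ge0 basisL) //; apply: p_induced_Res.
have [V V_p DRPhi] := p_induced_Res_Ind sTH b'_p.
have: coef BT b' ('Res[T] ('Ind[H] b')) != 0.
  rewrite DRPhi coefD paddr_eq0 ?(pbasis_ge0 basisT) //.
  by rewrite coef_id ?(pbasis_free basisT) // eqxx oner_eq0.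
have eD: coef BL nu ('Res[L] b) + coef BL nu ('Res[L] W) = e.
  by rewrite -coefD -linearD -DPhi.
rewrite {1}DPhi linearD coefD paddr_eq0 /=; last 2 first.
- by apply: (pbasis_ge0 basisT); apply: p_induced_Res.
- by apply: (pbasis_ge0 basisT); apply: p_induced_Res.
rewrite negb_and => /orP[/(le_e _ b_p) | /(le_e _ W_p)]; rewrite -eD.
  rewrite gerDl => leW0.
  have [W0 | nzW] := eqVneq W 0; first by rewrite DPhi W0 addr0.
  have [nu' overW] := over_ex basisL nsLH W_p nzW.
  have overPhi : over BL ('Ind[H] b') nu'.
    by rewrite DPhi (over_add basisL nsLH) ?overW ?orbT.
  have [h Hh Dnu'] := over_Ind basisL nsLH BLnu sLT sTH Rb' overPhi.
  move: overW; rewrite Dnu' (over_conjg basisL nsLH) // /over.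
  rewrite eq_le leW0 (pbasis_ge0 basisL) //; exact: p_induced_Res.
rewrite gerDr => leb0; move: over_b; rewrite /over eq_le leb0.
by rewrite (pbasis_ge0 basisL) //; apply: p_induced_Res.
Qed.

Lemma over_vanish b nu (BT : seq 'CF('I_H[nu])) y :
    pbasis p BT -> b \in BH -> over BL b nu -> 'I_H[nu] <| H ->
  y \notin 'I_H[nu] -> b y = 0.
Proof.
move=> basisT BHb over_b nsTH T'y.
have [b' [c [_ _ ->]]] := over_induced basisT BHb over_b.
by apply: (cfun_on0 (cfInd_normal _ nsTH)).
Qed.

Lemma cfInd1_abelian :
  abelian (H / L) -> 'Ind[H, L] 1 = \sum_i ('chi[H / L]_i %% L)%CF.
Proof.
move=> abHL; rewrite -[RHS]linear_sum /=.
have ->: \sum_i 'chi[H / L]_i = cfReg (H / L).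
  rewrite cfReg_sum; apply: eq_bigr => i _.
  by rewrite lin_char1 ?scale1r //; apply/char_abelianP.
apply/cfun_inP=> x Hx; rewrite cfInd_cfun1 // cfModE // cfRegE.
rewrite cfunE cfuniE // card_quotient ?normal_norm //.
rewrite mulr_natr; congr (_ *+ nat_of_bool _); apply/idP/eqP => [/coset_id // |].
by apply: coset_idr; apply: subsetP Hx; apply: normal_norm.
Qed.

(** As in Gallagher's theorem: up to the multiplicity of [nu] in [b], the function
    induced from [nu] is the sum of the products of [b] with the characters of
    [H / L]. *)
Lemma over_inv_mul b b' nu :
    abelian (H / L) -> H \subset 'I[nu] -> b \in BH -> b' \in BH ->
    over BL b nu -> over BL b' nu ->
  exists i, b' = b * ('chi[H / L]_i %% L)%CF.
Proof.
move=> abHL Inu BHb BHb' over_b over_b'.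
have Rb := cfRes_over_inv basisL nsLH basisH BHb over_b Inu.
have Db: \sum_i b * ('chi[H / L]_i %% L)%CF = coef BL nu ('Res[L] b) *: 'Ind[H] nu.
  rewrite -linearZ -Rb -mulr_sumr -cfInd1_abelian // mulrC -cfIndM //.
  by rewrite mul1r.
have: coef BH b' (\sum_i b * ('chi[H / L]_i %% L)%CF) != 0.
  rewrite Db coefZ mulf_neq0 //.
  exact: (over_constituent basisL nsLH basisH).
rewrite coef_big => nz_sum.
have [i nz_i]: exists i, coef BH b' (b * ('chi[H / L]_i %% L)%CF) != 0.
  apply/existsP; apply: contraNT nz_sum; rewrite negb_exists => /forallP z.
  by rewrite big1 // => i _; apply/eqP; have:= z i; rewrite negbK.
have Lchi: ('chi[H / L]_i %% L)%CF \is a linear_char.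
  by apply: cfMod_lin_char; apply/char_abelianP.
exists i; apply/esym/eqP; move: nz_i.
rewrite coef_id ?(pbasis_free basisH) ?(pbasis_mul_lin basisH) //.
by rewrite pnatr_eq0 eqb0 negbK.
Qed.

End CliffordCorrespondence.
Local Open Scope group_scope.
Local Open Scope ring_scope.

(** * The cyclic extension attached to an element *)

Section CyclicCoset.

Variables (gT : finGroupType) (L : {group gT}) (y : gT).
Hypothesis nLy : y \in 'N(L)%g.

(** The subgroup [L <[y]>] when [y] normalises [L], given as a preimage so that
    its quotient by [L] is cyclic by construction. *)
Definition cyclic_ext := (coset L @*^-1 <[coset L y]>)%G.
Local Notation X := cyclic_ext.

Lemma cyclic_ext_memP x :
  reflect (x \in 'N(L)%g /\ coset L x \in <[coset L y]>%g) (x \in X).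
Proof. exact: morphpreP. Qed.

Lemma cyclic_ext_gen : y \in X.
Proof. by apply/cyclic_ext_memP; rewrite cycle_id. Qed.

Lemma normal_cyclic_ext : L <| X.
Proof.
rewrite /normal; apply/andP; split; last by apply: subsetIl.
by apply: sub_cosetpre.
Qed.

Lemma quotient_cyclic_ext : (X / L = <[coset L y]>)%g.
Proof. exact: cosetpreK. Qed.

Lemma abelian_cyclic_ext : abelian (X / L).
Proof. by rewrite quotient_cyclic_ext cycle_abelian. Qed.

Lemma cyclic_ext_sub (Y : {group gT}) : L <| Y -> y \in Y -> X \subset Y.
Proof.
move=> nsLY Yy; rewrite -(quotientGK nsLY) morphpreS // cycle_subG.
exact: mem_quotient.
Qed.

Lemma cyclic_ext_min (T : {group gT}) x :
  L \subset T -> T \subset X -> x \in T -> coset L x = coset L y -> X \subset T.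
Proof.
move=> sLT sTX Tx Dx; have nsLT: L <| T := normalS sLT sTX normal_cyclic_ext.
rewrite -(quotientGK nsLT) morphpreS // cycle_subG -Dx.
exact: mem_quotient.
Qed.

Lemma cyclic_ext_subnormal (T : {group gT}) : L \subset T -> T \subset X -> T <| X.
Proof.
move=> sLT sTX; apply: sub_der1_normal => //; apply: subset_trans sLT.
rewrite der1_min ?abelian_cyclic_ext //; exact: normal_norm normal_cyclic_ext.
Qed.

(** Up to a scalar, the projection onto the functions supported on the coset
    [y L], obtained by Fourier inversion on [X / L]. *)
Definition coset_proj (Theta : 'CF(X)) : 'CF(X) :=
  \sum_i (('chi[X / L]_i (coset L y))^*) *: (Theta * ('chi_i %% L)%CF).

Fact coset_proj_linear : linear coset_proj.
Proof.
move=> a u v; rewrite /coset_proj scaler_sumr -big_split /=.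
apply: eq_bigr => i _; rewrite mulrDl scalerDr -scalerAl !scalerA.
by rewrite [X in X *: _ + _]mulrC.
Qed.
HB.instance Definition _ :=
  GRing.isLinear.Build algC 'CF(X) 'CF(X) _ coset_proj coset_proj_linear.

Lemma coset_proj_sum (I : Type) (r : seq I) (P : pred I) (F : I -> 'CF(X)) :
  coset_proj (\sum_(i <- r | P i) F i) = \sum_(i <- r | P i) coset_proj (F i).
Proof. exact: (linear_sum coset_proj). Qed.

Lemma coset_projZ a Theta : coset_proj (a *: Theta) = a *: coset_proj Theta.
Proof. exact: (linearZ_LR coset_proj). Qed.

Lemma coset_projE Theta x : x \in X -> coset_proj Theta x =
  #|'C_(X / L)[coset L x]|%:R *+ (coset L x \in (coset L y ^: (X / L))%g) * Theta x.
Proof.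
move=> Xx; have Xy := cyclic_ext_gen; rewrite -second_orthogonality_relation; last first.
  exact: mem_quotient.
rewrite mulr_suml sum_cfunE; apply: eq_bigr => i _.
by rewrite !cfunE cfModE ?normal_cyclic_ext // (mulrC (Theta x)) mulrCA mulrA.
Qed.

Lemma coset_proj_eq0 (Theta : 'CF(X)) :
    (forall x, x \in X -> coset L x = coset L y -> Theta x = 0) ->
  coset_proj Theta = 0.
Proof.
move=> Theta0; apply/cfun_inP=> x Xx; rewrite coset_projE // cfunE.
case: imsetP => [[z Xz Dx]|_]; last by rewrite mul0r.
rewrite Theta0 ?mulr0 // Dx; apply/conjg_fixP/commgP/(centsP abelian_cyclic_ext) => //.
by rewrite mem_quotient ?cyclic_ext_gen.
Qed.

Lemma coset_proj_inj Theta : coset_proj Theta = 0 -> Theta y = 0.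
Proof.
have Xy := cyclic_ext_gen.
move/cfunP/(_ y)/eqP; rewrite coset_projE // cfunE class_refl mulr1n mulf_eq0.
by rewrite (negPf (neq0CG _)) => /eqP.
Qed.

End CyclicCoset.
Local Open Scope group_scope.
Local Open Scope ring_scope.

Section MainStep.

Variables (gT : finGroupType) (p : nat) (G P K L : {group gT}).
Hypotheses (nsLG : (L <| G)%g) (nsKG : (K <| G)%g) (sLK : L \subset K).
Hypotheses (p'KL : p^'.-group (K / L)%g) (sylP : p.-Sylow(G) P).
Hypotheses (defG : (K * P = G)%g) (sPKL : P :&: K \subset L).

Let Y := (L <*> P)%G.
Let sLG := normal_sub nsLG.
Let nLG := normal_norm nsLG.
Let sKG := normal_sub nsKG.
Let nKG := normal_norm nsKG.
Let sPG := pHall_sub sylP.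
Let pP := pHall_pgroup sylP.

Let sYG : Y \subset G. Proof. by rewrite join_subG sLG. Qed.
Let sLY : L \subset Y. Proof. exact: joing_subl. Qed.
Let sPY : P \subset Y. Proof. exact: joing_subr. Qed.
Let nsLY : L <| Y. Proof. exact: normalS sLY sYG nsLG. Qed.
Let defY : (L * P)%g = Y.
Proof. by rewrite /Y /= norm_joinEr // (subset_trans sPG). Qed.
Let defKY : (K * Y)%g = G. 
Proof. by rewrite -defY mulgA (mulGSid sLK). Qed.
Let tiKY : K :&: Y \subset L.
Proof. by rewrite -defY setIC -group_modl // mul_subG. Qed.

Variables (BL : seq 'CF(L)) (BY : seq 'CF(Y)).
Hypotheses (basisL : pbasis p BL) (basisY : pbasis p BY).

Let cfconjM (nu : 'CF(L)) x y : x \in G -> y \in G ->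
  (nu ^ (x * y))%CF = ((nu ^ x) ^ y)%CF.
Proof. exact: (cfConjgM _ nsLG). Qed.

(** * Representatives of the orbits *)

Definition sylow_fixed (nu : 'CF(L)) := p.-Sylow('I_G[nu]) ('I_P[nu]).

(** A Sylow subgroup of the stabiliser of [nu] is conjugate into [P]. *)
Lemma sylow_fixed_conjg nu : exists2 g, g \in G & sylow_fixed (nu ^ g)%CF.
Proof.
have [Q sylQ] := Sylow_exists p ('I_G[nu])%G.
have sQG : Q \subset G := subset_trans (pHall_sub sylQ) (subsetIl _ _).
have [g Gg sQgP] := Sylow_Jsub sylP sQG (pHall_pgroup sylQ).
exists g => //; have nLg: g \in 'N(L) := subsetP nLG g Gg.
have DI: 'I_G[(nu ^ g)%CF] = ('I_G[nu] :^ g)%g.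
  by rewrite conjIg conjg_inertia // conjGid.
have sylQg : p.-Sylow('I_G[(nu ^ g)%CF]) (Q :^ g) by rewrite DI pHallJ2.
suff DT : 'I_P[(nu ^ g)%CF] = (Q :^ g)%g by rewrite /sylow_fixed DT.
apply: (sub_pHall sylQg).
- exact: pgroupS (subsetIl _ _) pP.
- by rewrite subsetI sQgP (subset_trans (pHall_sub sylQg)) ?subsetIr.
- exact: setSI.
Qed.

Definition orbit_repr (nu : 'CF(L)) : 'CF(L) :=
  nth nu BL (find (fun mu => sylow_fixed mu && (mu \in (nu ^: G)%CF)) BL).

Lemma orbit_reprP nu : nu \in BL ->
  [/\ orbit_repr nu \in BL, sylow_fixed (orbit_repr nu)
    & exists2 g, g \in G & orbit_repr nu = (nu ^ g)%CF].
Proof.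
move=> BLnu; set a := fun mu => sylow_fixed mu && (mu \in (nu ^: G)%CF).
have has_a: has a BL.
  have [g Gg fix_g] := sylow_fixed_conjg nu; apply/hasP.
  exists (nu ^ g)%CF; first exact: (pbasis_conjg basisL).
  by rewrite /a fix_g; apply/cfclassP; exists g.
have /andP[fix_r /cfclassP[g Gg Dr]] := nth_find nu has_a.
by split; rewrite ?mem_nth -?has_find //; exists g.
Qed.

Lemma orbit_repr_conjg nu g : nu \in BL -> g \in G ->
  orbit_repr (nu ^ g)%CF = orbit_repr nu.
Proof.
move=> BLnu Gg; rewrite /orbit_repr; set nu' := (nu ^ g)%CF.
have cl : (nu' ^: G =i nu ^: G)%CF.
  by move=> mu; apply/esym/cfclass_transr/cfclassP; exists g.
have Ea : (fun mu => sylow_fixed mu && (mu \in (nu' ^: G)%CF))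
       =1 (fun mu => sylow_fixed mu && (mu \in (nu ^: G)%CF)).
  by move=> mu /=; rewrite cl.
rewrite (eq_find Ea); apply: set_nth_default; rewrite -has_find.
have [BLr fix_r [h Gh Dr]] := orbit_reprP BLnu.
by apply/hasP; exists (orbit_repr nu); rewrite ?fix_r //; apply/cfclassP; exists h.
Qed.

(** Modulo [K] the stabiliser is a p-group, covered by its Sylow subgroup. *)
Lemma sylow_fixed_factor nu s : sylow_fixed nu -> s \in 'I_G[nu] ->
  exists2 t, t \in 'I_P[nu] & (s * t^-1)%g \in K.
Proof.
move=> syl_nu Is; have sIG : 'I_G[nu] \subset G := subsetIl _ _.
have nKI := subset_trans sIG nKG.
have nKT := subset_trans (pHall_sub syl_nu) nKI.
have pGK : p.-group (G / K)%g.
  by rewrite -defG quotientMidl quotient_pgroup.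
have sylT := quotient_pHall nKT syl_nu.
have pIK : p.-group ('I_G[nu] / K)%g := pgroupS (quotientS K sIG) pGK.
have : 'I_G[nu] \subset (K * 'I_P[nu])%g.
  by rewrite -quotientSK // (pHall_id sylT).
move/subsetP/(_ s Is)/mulsgP => [k t Kk Tt ->].
by exists t => //; rewrite mulgK.
Qed.

(** A basis element of [Y] is selected when it lies over such a [nu]. *)
Definition near_repr nu := orbit_repr nu \in (nu ^: Y)%CF.

Lemma near_repr_conjg nu z : nu \in BL -> z \in Y ->
  near_repr (nu ^ z)%CF = near_repr nu.
Proof.
move=> BLnu Yz; rewrite /near_repr orbit_repr_conjg ?(subsetP sYG) //.
by apply/esym/(cfclass_transr (G := Y))/cfclassP; exists z.
Qed.

(** If [nu] and its conjugate by [k] are carried to the representative by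
    [z] and [z'] in [Y], then [z^-1 * k * z'] fixes it, and this element is [t]
    modulo [K] for some [t] in [P] fixing it.  So [z^-1 * z'] and [t] differ by
    an element of [K :&: Y], that is of [L], and [z^-1 * z'] fixes the
    representative as well. *)
Lemma near_repr_conj_inj nu k : nu \in BL -> k \in K ->
  near_repr nu -> near_repr (nu ^ k)%CF -> (nu ^ k)%CF = nu.
Proof.
move=> BLnu Kk; have Gk := subsetP sKG k Kk; have GY := subsetP sYG.
have [BLr fix_r _] := orbit_reprP BLnu.
rewrite /near_repr orbit_repr_conjg //; set nu0 := orbit_repr nu in BLr fix_r *.
case/cfclassP=> z Yz D1 /cfclassP[z' Yz' D2].
have Gz := GY z Yz; have Gz' := GY z' Yz'.
have Is : (z^-1 * k * z')%g \in 'I_G[nu0].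
  have Gzkz : (z^-1 * k * z')%g \in G by rewrite !groupM ?groupV.
  apply/setIP; split=> //; rewrite inE (subsetP nLG) //=.
  by rewrite {1}D1 -cfconjM // !mulgA mulgV mul1g cfconjM // -D2.
have [t] := sylow_fixed_factor fix_r Is; rewrite inE => /andP[Pt It] Kst.
have Gt := subsetP sPG t Pt.
have Lzzt : (z^-1 * z' * t^-1)%g \in L.
  apply: (subsetP tiKY); apply/setIP; split; last first.
    by rewrite !groupM ?groupV ?(subsetP sPY t).
  have -> : (z^-1 * z' * t^-1 = (k^-1 ^ z) * (z^-1 * k * z' * t^-1))%g.
    by rewrite conjgE !mulgA mulgK mulgKV.
  by rewrite groupM // memJ_norm ?groupV // (subsetP nKG).
have Dzz: (nu0 ^ (z^-1 * z'))%CF = nu0.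
  have ->: (z^-1 * z' = (z^-1 * z' * t^-1) * t)%g by rewrite mulgKV.
  by rewrite cfconjM ?groupM ?groupV // (cfConjg_id _ Lzzt) inertiaJ.
have D1' : nu = (nu0 ^ z^-1)%CF by rewrite D1 -cfconjM ?groupV // mulgV cfConjgJ1.
have D2' : (nu ^ k)%CF = (nu0 ^ z'^-1)%CF.
  by rewrite D2 -cfconjM ?groupV // mulgV cfConjgJ1.
rewrite D2' -{1}Dzz -cfconjM ?groupM ?groupV // mulgK.
by rewrite -D1'.
Qed.


(** * The basis for G *)

Hypothesis proper_basis : forall H : {group gT}, H \proper G ->
  exists B : seq 'CF(H), pbasis p B.
Hypothesis prYG : Y \proper G.

Let sub_basis (H : {group gT}) : H \subset Y -> exists B : seq 'CF(H), pbasis p B.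
Proof. by move=> sHY; apply: proper_basis; apply: sub_proper_trans prYG. Qed.

Definition near_basis : seq 'CF(Y) :=
  [seq f <- BY | has (fun nu => over BL f nu && near_repr nu) BL].

Lemma near_basis_sub f : f \in near_basis -> f \in BY.
Proof. by rewrite mem_filter => /andP[]. Qed.

Lemma near_basis_over f nu : f \in near_basis -> over BL f nu -> near_repr nu.
Proof.
rewrite mem_filter => /andP[/hasP[mu BLmu /andP[over_mu near_mu]] BYf] over_nu.
have [z Yz ->] := over_orbit basisL nsLY basisY BYf over_mu over_nu.
by rewrite near_repr_conjg.
Qed.

Lemma near_basis_mem f nu :
  f \in BY -> over BL f nu -> near_repr nu -> f \in near_basis.
Proof.
move=> BYf over_nu near_nu; rewrite mem_filter BYf andbT; apply/hasP.
by exists nu; rewrite ?over_nu ?(over_mem over_nu).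
Qed.

(** By Clifford's correspondence [f] is induced from the stabiliser [T] of some
    [nu], and [T = L Q] for a p-subgroup [Q].  Some [x] carries [nu] to the
    representative and [Q] into [P], as [P] contains a Sylow subgroup of the
    stabiliser of the representative.  Conjugation by [x] moves [T] into [Y]
    without changing the function induced to [G]. *)
Lemma Ind_near_repr f : f \in BY ->
  exists Theta, [/\ p_induced p Theta,
    forall nu, over BL Theta nu -> near_repr nu & 'Ind[G] f = 'Ind[G, Y] Theta].
Proof.
move=> BYf; have f_p := pbasis_pmon basisY BYf.
have [nu over_f] := over_ex basisL nsLY f_p (nat_basis_neq0 basisY BYf).
have BLnu := over_mem over_f; set T := ('I_Y[nu])%G.
have sTY : T \subset Y := subsetIl _ _; have sTG := subset_trans sTY sYG.
have [BT basisT] := sub_basis sTY.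
have [b [c [b_p Rb Df]]] := over_induced nsLY basisL basisY basisT BYf over_f.
have [BLr fix_r [g Gg Dr]] := orbit_reprP BLnu.
set nu0 := orbit_repr nu in BLr fix_r Dr.
have nLg := subsetP nLG g Gg.
have [Q sylQ] := Sylow_exists p T.
have sQT := pHall_sub sylQ.
have sLT : L \subset T by rewrite subsetI sLY sub_inertia.
have sQgI : Q :^ g \subset 'I_G[nu0].
  rewrite subsetI conj_subG ?(subset_trans sQT) //= Dr -conjg_inertia // conjSg.
  exact: subset_trans sQT (subsetIr _ _).
have pQg : p.-group (Q :^ g) by rewrite pgroupJ (pHall_pgroup sylQ).
have [s Is sQgsP] := Sylow_Jsub (P := 'I_P[nu0]%G) fix_r sQgI pQg.
have /setIP[Gs Is'] := Is; set x := (g * s)%g.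
have Gx : x \in G by rewrite groupM.
have nLx : x \in 'N(L) := subsetP nLG x Gx.
have Dnux : (nu ^ x)%CF = nu0 by rewrite cfconjM // -Dr inertiaJ.
have nLT : T \subset 'N(L) := subset_trans sTG nLG.
have nLQ : Q \subset 'N(L) := subset_trans sQT nLT.
have sTLQ : T \subset (L * Q)%g.
  have sylQL := quotient_pHall nLQ sylQ.
  rewrite -quotientSK // (pHall_id sylQL) //; apply: pgroupS (quotientS L sTY) _.
  by rewrite /= -defY quotientMidl quotient_pgroup.
have sTxY : T :^ x \subset Y.
  apply: subset_trans (_ : T :^ x \subset (L * Q) :^ x) _; first by rewrite conjSg.
  rewrite conjsMg (normP nLx) -defY mulgS // conjsgM.
  exact: subset_trans sQgsP (subsetIl _ _).
have sLTx : L \subset T :^ x by rewrite -(normP nLx) conjSg.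
exists ('Ind[Y] (cfJ x b)).
have Rbx : 'Res[L] (cfJ x b) = c *: nu0.
  apply/cfun_inP=> u Lu; rewrite cfResE // cfJE cfunE -Dnux cfConjgE //.
  have Lux : (u ^ x^-1)%g \in L by rewrite memJ_norm ?groupV.
  by rewrite -(cfResE b sLT) // Rb cfunE.
split.
- by apply: p_induced_Ind => //; apply: p_induced_cfJ.
- move=> mu over_mu.
  have [z Yz ->] := over_Ind basisL nsLY BLr sLTx sTxY Rbx over_mu.
  rewrite near_repr_conjg // /near_repr {1}Dr orbit_repr_conjg //.
  exact: cfclass_refl.
by rewrite cfIndInd // cfInd_cfJ // Df cfIndInd.
Qed.

(** The conjugates by [Y] of an element contribute equally to the induced
    function, and [G = K Y]. *)
Lemma sum_conj_Ind0 (Psi : 'CF(Y)) x :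
  'Ind[G] Psi = 0 -> \sum_(k in K) Psi (x ^ k)%g = 0.
Proof.
move/cfunP/(_ x)/eqP; rewrite cfIndE // cfunE mulf_eq0 invr_eq0 (negPf (neq0CG _)).
rewrite -{1}defKY (@sum_mulG _ K Y) => [|z Yz k]; last by rewrite conjgM cfunJ.
by rewrite !mulf_eq0 invr_eq0 !(negPf (neq0CG _)) => /eqP.
Qed.

Section OneElement.

Variable y : gT.
Hypotheses (Yy : y \in Y) (p_y : p.-elt y).

Let X := cyclic_ext L y.
Let nLy : y \in 'N(L). Proof. by rewrite (subsetP nLG) ?(subsetP sYG). Qed.
Let sXY : X \subset Y. Proof. exact: cyclic_ext_sub. Qed.
Let nsLX : L <| X. Proof. exact: normal_cyclic_ext. Qed.
Let sLX : L \subset X := normal_sub nsLX.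
Let abXL : abelian (X / L). Proof. exact: abelian_cyclic_ext. Qed.
Let sXG : X \subset G := subset_trans sXY sYG.

Variable BX : seq 'CF(X).
Hypothesis basisX : pbasis p BX.

(** The centraliser of [y] modulo [L] in [K].  It normalises [X] and acts
    trivially on [X / L]. *)
Let C := (K :&: coset L @*^-1 'C[coset L y])%G.

Let memC k : k \in C ->
  [/\ k \in K, k \in G, k \in 'N(L) & coset L k \in 'C[coset L y]].
Proof.
case/setIP=> Kk /morphpreP[nLk Ck]; split=> //; exact: (subsetP sKG).
Qed.

Let cosetC k x : k \in C -> x \in X -> coset L (x ^ k)%g = coset L x.
Proof.
case/memC=> _ _ nLk Ck /cyclic_ext_memP[nLx Xx]; rewrite morphJ //.
apply/conjg_fixP/commgP; red.
by rewrite -cent_cycle in Ck; rewrite (centP Ck).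
Qed.

Let nXC k : k \in C -> k \in 'N(X).
Proof.
move=> Ck; have [_ _ nLk _] := memC Ck; rewrite inE.
apply/subsetP=> _ /imsetP[x Xx ->]; apply/cyclic_ext_memP.
have [nLx Xx'] := cyclic_ext_memP _ _ _ Xx.
by rewrite cosetC // groupJ.
Qed.

Let lam i := ('chi[X / L]_i %% L)%CF : 'CF(X).

Let lam_lin i : lam i \is a linear_char.
Proof. by apply: cfMod_lin_char; apply/char_abelianP. Qed.

Let lamC i k : k \in C -> (lam i ^ k)%CF = lam i.
Proof.
move=> Ck; apply/cfun_inP=> x Xx; have nXk := nXC Ck.
have Xxk : (x ^ k^-1)%g \in X by rewrite memJ_norm ?groupV.
by rewrite cfConjgE // !cfModE // cosetC ?groupV.
Qed.

Let projC (Theta : 'CF(X)) k : k \in C ->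
  coset_proj (Theta ^ k)%CF = (coset_proj Theta ^ k)%CF.
Proof.
move=> Ck; rewrite /coset_proj linear_sum; apply: eq_bigr => i _.
by rewrite linearZ /= rmorphM /= lamC.
Qed.

(** For [x] in [y L], the conjugate of [x] by an element of [K] lies in [Y] only
    if it lies in [x (K :&: Y)], which is contained in [y L]. *)
Let proj_sum_conj (Psi : 'CF(Y)) : 'Ind[G] Psi = 0 ->
  \sum_(k in C) (coset_proj ('Res[X] Psi) ^ k^-1)%CF = 0.
Proof.
move=> Ind0; under eq_bigr => k Ck do rewrite -projC ?groupV //.
rewrite -coset_proj_sum; apply: (coset_proj_eq0 nLy) => x Xx Dx.
have Yx := subsetP sXY x Xx; rewrite sum_cfunE -[RHS](sum_conj_Ind0 x Ind0).
rewrite [RHS](big_setID C) /= [X in _ + X]big1 => [|k /setDP[Kk C'k]].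
  rewrite addr0 (setIidPr (subsetIl K _)); apply: eq_bigr => k Ck.
  have nXk := nXC Ck.
  by rewrite cfConjgE ?groupV // invgK cfResE // memJ_norm.
apply: cfun0; apply: contra C'k => Yxk.
have Gk := subsetP sKG k Kk; have nLk := subsetP nLG k Gk.
have [nLx _] := cyclic_ext_memP _ _ _ Xx.
rewrite inE Kk; apply/morphpreP; split=> //; rewrite -Dx.
have Lc : [~ x, k]%g \in L.
  apply: (subsetP tiKY); apply/setIP; split; last first.
    by rewrite commgEl groupM ?groupV.
  rewrite commgEr groupM ?groupV // memJ_norm ?groupV //.
  by rewrite (subsetP nKG) ?(subsetP sXG).
apply/cent1P/esym/commgP; rewrite -morphR //; apply/eqP; exact: coset_id.
Qed.

Let span_proj (Theta : 'CF(X)) :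
  Theta \in <<BX>>%VS -> coset_proj Theta \in <<BX>>%VS.
Proof.
move/(coef_expand_span (pbasis_free basisX))->; rewrite coset_proj_sum big_seq.
apply: memv_suml => b BXb; rewrite coset_projZ memvZ //.
apply: memv_suml => i _; rewrite memvZ // memv_span //.
exact: (pbasis_mul_lin basisX (lam_lin i) BXb).
Qed.

(** If the [L]-constituents of [b'] are not fixed by [X], then [b'] is induced from
    a proper subgroup of [X] containing [L], and such a subgroup does not meet
    [y L]; so [b'] has no projection. *)
Let over_proj b b' : b \in BX -> b' \in BX -> coef BX b (coset_proj b') != 0 ->
  exists nu, [/\ over BL b nu, over BL b' nu & X \subset 'I[nu]].
Proof.
move=> BXb BXb' nz_c; have b'_p := pbasis_pmon basisX BXb'.
have [nu over_b'] := over_ex basisL nsLX b'_p (nat_basis_neq0 basisX BXb').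
have [i Db] : exists i, b = b' * lam i.
  have [i nz_i] : exists i, coef BX b (b' * lam i) != 0.
    apply/existsP; apply: contraNT nz_c; rewrite negb_exists => /forallP z.
    rewrite /coset_proj coef_big big1 // => i _; apply/eqP.
    by rewrite coefZ mulf_eq0; have:= z i; rewrite negbK => ->; rewrite orbT.
  exists i; apply/esym/eqP; move: nz_i.
  rewrite coef_id ?(pbasis_free basisX) ?(pbasis_mul_lin basisX) //.
  by rewrite pnatr_eq0 eqb0 negbK.
exists nu; split=> //.
  rewrite /over; suff -> : 'Res[L] b = 'Res[L] b' by [].
  apply/cfun_inP=> u Lu; have Xu := subsetP sLX u Lu.
  rewrite !cfResE // Db cfunE cfModE // coset_id // lin_char1 ?mulr1 //.
  exact/char_abelianP.
have sIX : 'I_X[nu] \subset X := subsetIl _ _.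
have sLI : L \subset 'I_X[nu] by apply: sub_Inertia.
have [BT basisT] := sub_basis (subset_trans sIX sXY).
apply: contraR nz_c => not_sXI; apply/eqP; rewrite (coset_proj_eq0 nLy) ?coef0 //.
move=> x Xx Dx.
apply: (over_vanish nsLX basisL basisX basisT BXb' over_b').
  exact: cyclic_ext_subnormal.
apply: contra not_sXI => Ix.
by apply: subset_trans (subsetIr X _); apply: cyclic_ext_min Ix Dx.
Qed.

Let over_conjC b nu k : b \in BX -> k \in C -> over BL b nu ->
  over BL (b ^ k)%CF (nu ^ k)%CF.
Proof.
move=> BXb Ck; have [_ _ nLk _] := memC Ck; rewrite /over.
rewrite -cfConjgRes_norm ?nXC // (coef_conjg basisL) //.
by apply: (pbasis_span basisL); apply: p_induced_Res => //; apply: pbasis_pmon BXb.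
Qed.

(** Conjugation by [k] multiplies [b] by a linear character of the p-group
    [X / L], which is fixed by [k].  Its power of exponent [#|K / L|] fixes [b],
    since the corresponding power of [k] lies in [L]; the order of the character
    being prime to this exponent, the character itself fixes [b]. *)
Let conjC_fixed b nu k : b \in BX -> k \in C -> X \subset 'I[nu] ->
  over BL b nu -> over BL (b ^ k)%CF nu -> (b ^ k)%CF = b.
Proof.
move=> BXb Ck Inu over_b over_bk; have [Kk _ nLk _] := memC Ck.
have BXbk : (b ^ k)%CF \in BX by apply: (pbasis_conjg basisX).
have [i Dbk] := over_inv_mul nsLX basisL basisX abXL Inu BXb BXbk over_b over_bk.
rewrite -/(lam i) in Dbk.
have bX j : (b ^ (k ^+ j)%g)%CF = b * lam i ^+ j.
  elim: j => [|j IHj]; first by rewrite expr0 mulr1 cfConjgJ1.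
  rewrite expgSr (cfConjgM _ (normalG X)) ?groupX ?nXC // IHj rmorphM rmorphXn /=.
  by rewrite lamC // Dbk exprS mulrA.
set n := #|(K / L)%g|; set q := #|(X / L)%g|.
have bn : b * lam i ^+ n = b.
  rewrite -bX cfConjg_id //; apply: (subsetP sLX).
  apply: coset_idr; first by rewrite groupX.
  by rewrite morphX // expg_cardG // mem_quotient.
have lamq : lam i ^+ q = 1.
  apply/cfun_inP=> x Xx; rewrite exp_cfunE // cfun1E Xx.
  rewrite -lin_charX // cfModE ?groupX // morphX ?(subsetP (normal_norm nsLX)) //.
  rewrite expg_cardG ?mem_quotient // lin_char1 //; exact/char_abelianP.
have co_nq : coprime n q.
  rewrite coprime_sym; apply: (pnat_coprime (pi := p)) => //.
  by rewrite -/(p.-group _) quotient_cyclic_ext; exact: morph_p_elt.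
have bnX m : b * lam i ^+ (n * m) = b.
  elim: m => [|m IHm]; first by rewrite muln0 expr0 mulr1.
  by rewrite mulnS exprD mulrA bn.
case: (egcdnP q (cardG_gt0 (K / L)%G)) => u v; rewrite -/n (eqP co_nq) => Duv _.
rewrite Dbk -[RHS](bnX u) mulnC Duv addn1 exprS mulnC exprM lamq expr1n mulr1.
by [].
Qed.

(** The projection of [Psi] only involves elements of the basis of [X] over fixed
    constituents that satisfy [near_repr].  In the sum of its conjugates by [C],
    the coefficient of such an element [b] is a sum of coefficients of conjugates
    of [b].  By [near_repr_conj_inj] and [conjC_fixed] the nonzero ones are all
    equal to that of [b], which therefore vanishes. *)
Lemma near_vanish_p Psi : Psi \in <<near_basis>>%VS -> 'Ind[G] Psi = 0 -> Psi y = 0.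
Proof.
move=> near_Psi Ind0; have Xy : y \in X := cyclic_ext_gen nLy.
rewrite -(cfResE Psi sXY) //; apply: (coset_proj_inj nLy).
set Omega := coset_proj _.
have uF : free near_basis.
  by apply: filter_free; apply: pbasis_free basisY.
have DPsi := coef_expand_span uF near_Psi.
have spanF f : f \in near_basis -> p_induced p ('Res[X] f).
  by move/near_basis_sub=> BYf; apply: p_induced_Res => //; apply: pbasis_pmon BYf.
have DRPsi : 'Res[X] Psi = \sum_(f <- near_basis) coef near_basis f Psi *: 'Res[X] f.
  by rewrite {1}DPsi linear_sum; apply: eq_bigr => f _; rewrite linearZ.
have RPsi : 'Res[X] Psi \in <<BX>>%VS.
  rewrite DRPsi big_seq memv_suml // => f Ff.
  by rewrite memvZ //; apply: (pbasis_span basisX); apply: spanF.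
have Omega_span : Omega \in <<BX>>%VS by apply: span_proj.
pose c b := coef BX b Omega.
have nz_c b : b \in BX -> c b != 0 ->
  exists nu, [/\ over BL b nu, near_repr nu & X \subset 'I[nu]].
- move=> BXb; rewrite /c /Omega DRPsi coset_proj_sum coef_big big_seq => nz_sum.
  have [f Ff nz_f] : exists2 f, f \in near_basis & coef BX b (coset_proj ('Res[X] f)) != 0.
    apply/hasP; apply: contraNT nz_sum => /hasPn z; rewrite big1 // => f /z.
    by rewrite negbK coset_projZ coefZ => /eqP->; rewrite mulr0.
  move: nz_f; rewrite {1}(pbasis_expand basisX (spanF f Ff)) coset_proj_sum coef_big.
  rewrite big_seq => nz_sum'.
  have [b' BXb' /andP[nz_b' nz_bb']] : exists2 b', b' \in BX &
    (coef BX b' ('Res[X] f) != 0) && (coef BX b (coset_proj b') != 0).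
  - apply/hasP; apply: contraNT nz_sum' => /hasPn z; rewrite big1 // => b' /z.
    rewrite negb_and !negbK coset_projZ coefZ => /orP[] /eqP->.
      by rewrite mul0r.
    by rewrite mulr0.
  have [nu [over_b over_b' Inu]] := over_proj BXb BXb' nz_bb'.
  exists nu; split=> //; apply: (near_basis_over Ff).
  have [W W_p DRf] := pbasis_occurs basisX (spanF f Ff) nz_b'.
  rewrite /over -(cfResRes f sLX sXY) DRf -/(over BL _ nu).
  by rewrite (over_add basisL nsLX) ?over_b' //; apply: pbasis_pmon BXb'.
have cC b k : b \in BX -> k \in C -> c b != 0 -> c (b ^ k)%CF != 0 ->
  c (b ^ k)%CF = c b.
  move=> BXb Ck nz_b nz_bk; have [Kk _ nLk _] := memC Ck.
  have BXbk : (b ^ k)%CF \in BX by apply: (pbasis_conjg basisX).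
  have [nu [over_b near_nu Inu]] := nz_c b BXb nz_b.
  have [nu' [over_bk near_nu' Inu']] := nz_c _ BXbk nz_bk.
  have BLnu := over_mem over_b.
  have over_bk' := over_conjC BXb Ck over_b.
  have [x Xx Dnuk] := over_orbit basisL nsLX basisX BXbk over_bk over_bk'.
  rewrite (inertiaJ (subsetP Inu' x Xx)) in Dnuk.
  have Dnu : (nu ^ k)%CF = nu by apply: near_repr_conj_inj; rewrite ?Dnuk.
  by rewrite Dnu in over_bk'; rewrite (conjC_fixed BXb Ck Inu over_b).
rewrite (coef_expand_span (pbasis_free basisX) Omega_span) big_seq big1 // => b BXb.
have [-> | nz_b] := eqVneq (coef BX b Omega) 0; first exact: scale0r.
have /eqP[] : \sum_(k in C) c (b ^ k)%CF != 0.
  pose nonzero k := nat_of_bool (c (b ^ k)%CF != 0).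
  have -> : \sum_(k in C) c (b ^ k)%CF = (\sum_(k in C) nonzero k)%N%:R * c b.
    rewrite natr_sum mulr_suml; apply: eq_bigr => k Ck; rewrite /nonzero.
    by case: eqP => [-> | /eqP nz_bk]; rewrite ?mul0r // mul1r; apply: cC.
  rewrite mulf_neq0 // pnatr_eq0 -lt0n (bigD1 1%g) ?group1 //=.
  by rewrite /nonzero cfConjgJ1 /c nz_b.
have := congr1 (coef BX b) (proj_sum_conj Ind0); rewrite coef0 coef_big => E.
rewrite -[RHS]E; apply: eq_bigr => k Ck.
by rewrite -{2}(cfConjgK k b) (coef_conjg basisX).
Qed.

End OneElement.

Lemma near_independent Psi :
  Psi \in <<near_basis>>%VS -> 'Ind[G] Psi = 0 -> Psi = 0.
Proof.
move=> near_Psi Ind0; apply/cfun_inP=> y Yy; rewrite cfunE.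
have [p_y | p'y] := boolP (p.-elt y).
  have [BX basisX] := sub_basis (cyclic_ext_sub nsLY Yy).
  exact: (near_vanish_p Yy p_y basisX).
have uF : free near_basis.
  by apply: filter_free; apply: pbasis_free basisY.
rewrite (coef_expand_span uF near_Psi) sum_cfunE big_seq big1 // => f.
move/near_basis_sub=> BYf; rewrite cfunE.
by rewrite (p_induced_p_elt (pbasis_pmon basisY BYf) p'y) mulr0.
Qed.

(** Inducing any member of the basis of [Y] gives, by [Ind_near_repr], the same
    as inducing a sum of members that belong to [near_basis]. *)
Lemma induced_basis : exists B : seq 'CF(G), pbasis p B.
Proof.
have frF : free near_basis by apply: filter_free; apply: pbasis_free basisY.
have frB := free_map_linear (f := cfInd G) frF near_independent.
exists (map (cfInd G) near_basis); split=> // [_ /mapP[f Ff ->] | Phi Phi_p].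
  by apply: p_induced_Ind => //; apply: (pbasis_pmon basisY); apply: near_basis_sub.
have span_Ind Theta : p_induced p Theta ->
    (forall f, f \in BY -> coef BY f Theta != 0 ->
       nat_span (map (cfInd G) near_basis) ('Ind[G] f)) ->
  nat_span (map (cfInd G) near_basis) ('Ind[G, Y] Theta).
- move=> Theta_p spanT; rewrite (pbasis_expand basisY Theta_p) linear_sum.
  apply: nat_span_sum => f BYf _; rewrite linearZ /=.
  have [-> | nz_f] := eqVneq (coef BY f Theta) 0.
    by rewrite scale0r; apply: nat_span0.
  have /natrP[n ->] := pbasis_nat basisY f Theta_p.
  by rewrite scaler_nat; apply/nat_spanMn/spanT.
have [beta Nbeta ->] := p_induced_Sylow sylP Phi_p.
rewrite -(cfIndInd _ sYG sPY); apply: (span_Ind) => [|f BYf _].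
  exact: p_induced_Ind_char.
have [Theta [Theta_p near_Theta ->]] := Ind_near_repr BYf.
apply: span_Ind => // f' BYf' f'_Theta.
apply: nat_span_mem (free_uniq frB) (map_f _ _).
have f'_p := pbasis_pmon basisY BYf'.
have [nu over_f'] := over_ex basisL nsLY f'_p (nat_basis_neq0 basisY BYf').
apply: near_basis_mem (over_f') _ => //; apply: near_Theta.
have [W W_p DTheta] := pbasis_occurs basisY Theta_p f'_Theta.
by rewrite DTheta (over_add basisL nsLY nu f'_p W_p) over_f'.
Qed.

End MainStep.
Local Open Scope group_scope.

(** * p-solvable groups *)

Lemma pgroup_elts (gT : finGroupType) (pi : nat_pred) (G : {group gT}) :
  {in G, forall x, pi.-elt x} -> pi.-group G.
Proof.
move=> piG; apply/pgroupP => q q_pr /(Cauchy q_pr)[x Gx ox].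
by have := piG x Gx; rewrite /p_elt ox pnatE.
Qed.

Lemma pi_elt_trivial (gT : finGroupType) (pi : nat_pred) (x : gT) :
  pi.-elt x -> pi^'.-elt x -> x = 1.
Proof.
move=> pi_x pi'x; apply/eqP; rewrite -order_eq1.
exact/eqP/(pnat_1 pi_x pi'x).
Qed.

Section PiGenerated.

Variable gT : finGroupType.
Implicit Types (G H J K N : {group gT}) (pi : nat_pred) (p : nat).

Definition pi_gen pi G := <<[set x in G | pi.-elt x]>>%G.

Lemma pi_gen_mem pi G x : x \in G -> pi.-elt x -> x \in pi_gen pi G.
Proof. by move=> Gx pi_x; rewrite mem_gen // inE Gx. Qed.

Lemma pi_gen_sub pi G : pi_gen pi G \subset G.
Proof. by rewrite gen_subG; apply/subsetP=> x; rewrite inE => /andP[]. Qed.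

Lemma pi_gen_normal pi G H : G <| H -> pi_gen pi G <| H.
Proof.
case/andP=> sGH nGH; rewrite /normal (subset_trans (pi_gen_sub _ _)) //=.
apply: norms_gen; apply/subsetP=> h Hh; rewrite inE.
apply/subsetP=> _ /imsetP[x /[!inE] /andP[Gx pi_x] ->].
by rewrite p_eltJ pi_x memJ_norm ?(subsetP nGH) ?Gx.
Qed.

Lemma pi_gen_quotient pi G : pi^'.-group (G / pi_gen pi G).
Proof.
have nG := normal_norm (pi_gen_normal pi (normal_refl G)).
apply: pgroup_elts => _ /morphimP[x nx Gx ->].
have Gpi : x.`_pi \in G by apply: groupX.
have Gpi' : x.`_pi^' \in G by apply: groupX.
rewrite -(consttC pi x) morphM ?(subsetP nG) //.
rewrite [coset_morphism _ x.`_pi]coset_id ?mul1g; last first.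
  by rewrite pi_gen_mem ?p_elt_constt.
by apply: morph_p_elt; rewrite ?(subsetP nG) ?p_elt_constt.
Qed.

Lemma pi_elt_quotient pi G N x :
  N <| G -> pi^'.-group (G / N) -> x \in G -> pi.-elt x -> x \in N.
Proof.
case/andP=> _ nNG pi'GN Gx pi_x; have nNx := subsetP nNG x Gx.
apply: coset_idr => //; apply: (@pi_elt_trivial _ pi).
  exact: morph_p_elt.
by apply: mem_p_elt pi'GN _; apply: mem_quotient.
Qed.

(** Unlike a condition on the chief factors of [G], this one passes to
    subgroups by definition. *)
Definition p_separable p G := forall J, J \subset G -> J :!=: 1 ->
  exists N, [/\ N <| J, ~~ (J \subset N)
              & p.-group (J / N) || p^'.-group (J / N)].

Lemma p_separableS p G H : H \subset G -> p_separable p G -> p_separable p H.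
Proof. by move=> sHG sepG J sJH; apply: sepG; apply: subset_trans sHG. Qed.

(** Let [U] be the least normal subgroup of [G] containing [J], and [U / V] a
    chief factor; then [J] is not contained in [V], and [J / (V :&: J)] embeds
    into [U / V]. *)
Lemma p_solvable_separable p G : p_solvable p G -> p_separable p G.
Proof.
move=> solG J sJG ntJ; pose above (U : {group gT}) := (U <| G) && (J \subset U).
have [|U minU _] := @mingroup_exists _ above G; first by rewrite /above normal_refl.
have [/andP[nsUG sJU] {}minU] := mingroupP minU.
pose below (V : {group gT}) := (V \proper U) && (G \subset 'N(V)).
have [|V maxV _] := @maxgroup_exists _ below 1%G.
  rewrite /below norms1 andbT proper1G; apply: contraNneq ntJ => U1.
  by rewrite -subG1 -U1.
have /andP[prVU nVG] := maxgroupp maxV; have sVU := proper_sub prVU.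
have nsVG : V <| G by rewrite /normal nVG (subset_trans sVU) ?normal_sub.
have chUV : chief_factor G V U by rewrite /chief_factor nsUG andbT.
have {solG} : p.-group (U / V) || p^'.-group (U / V).
  by move/forallP/(_ U)/forallP/(_ V)/implyP: solG; apply.
have nVJ : J \subset 'N(V) := subset_trans sJG nVG.
have sJVUV : J / V \subset U / V by apply: quotientS.
have isoJ := second_isog nVJ.
move=> piUV; exists (V :&: J)%G; split.
- by rewrite /normal subsetIr normsI ?normG.
- apply: contraL prVU => sJVJ; rewrite properE negb_and negbK; apply/orP; right.
  rewrite (minU V) // /above nsVG (subset_trans sJVJ) //; exact: subsetIl.
by rewrite !(isog_pgroup _ isoJ); case/orP: piUV => /(pgroupS sJVUV)->; rewrite ?orbT.
Qed.

End PiGenerated.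

Section Existence.

Variables (gT : finGroupType) (p : nat).
Implicit Type G : {group gT}.

Lemma pgroup_basis G : p.-group G -> pbasis p (irr G).
Proof.
move=> pG; split=> [|chi irr_chi | Phi Phi_p]; first exact: irr_free.
  by rewrite -[chi]cfInd_id; apply: p_induced_Ind_char (irrWchar irr_chi).
have /char_sum_irr[r ->] := p_induced_char Phi_p.
apply: nat_span_sum => i _ _; apply: nat_span_mem (mem_irr i).
exact: free_uniq (irr_free G).
Qed.

(** The groups [K] and [L] are those of the introduction.  If [L] were
    equal to [K], a normal subgroup [N] of [K] with [K / N] a p-group or a
    p'-group would contain the generators of [K] and be equal to it. *)
Theorem p_separable_basis G : p_separable p G -> exists B : seq 'CF(G), pbasis p B.
Proof.
have [n leGn] := ubnP #|G|; elim: n => // n IHn in G leGn * => sepG.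
have [pG | not_pG] := boolP (p.-group G); first by exists (irr G); apply: pgroup_basis.
have proper_basis (H : {group gT}) : H \proper G -> exists B : seq 'CF(H), pbasis p B.
  move=> prHG; apply: IHn; first exact: leq_trans (proper_card prHG) _.
  exact: p_separableS (proper_sub prHG) sepG.
pose K := pi_gen p^' G; pose L := pi_gen p K.
have nsKG : K <| G by apply: pi_gen_normal.
have nsLG : L <| G by apply: pi_gen_normal.
have sKG := normal_sub nsKG; have sLK : L \subset K := pi_gen_sub _ _.
have p'KL : p^'.-group (K / L) := pi_gen_quotient _ _.
have pGK : p.-group (G / K).
  by have := pi_gen_quotient p^' G; rewrite pgroupNK.
have ntK : K :!=: 1.
  apply: contraNneq not_pG => K1; move: pGK; rewrite K1.
  by rewrite -(isog_pgroup _ (quotient1_isog G)).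
have not_sKL : ~~ (K \subset L).
  have [N [nsNK not_sKN piKN]] := sepG K sKG ntK.
  apply: contra not_sKN => sKL; apply: subset_trans sKL _.
  case/orP: piKN => [pKN | p'KN]; rewrite gen_subG; apply/subsetP=> x.
    rewrite inE => /andP[Kx _]; apply: subsetP x Kx; rewrite gen_subG.
    apply/subsetP=> x; rewrite inE => /andP[Gx p'x].
    apply: (pi_elt_quotient nsNK _ _ p'x); first by rewrite pgroupNK.
    exact: pi_gen_mem.
  by rewrite inE => /andP[Kx p_x]; apply: (pi_elt_quotient nsNK p'KN).
have [P sylP] := Sylow_exists p G; have sPG := pHall_sub sylP.
have defG : (K * P)%g = G.
  apply/eqP; rewrite eqEsubset mul_subG //=.
  have nKG := normal_norm nsKG; have nKP := subset_trans sPG nKG.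
  by rewrite -quotientSK // (pHall_id (quotient_pHall nKP sylP)).
have sPKL : P :&: K \subset L.
  apply/subsetP=> x /setIP[Px Kx]; apply: pi_gen_mem => //.
  exact: mem_p_elt (pHall_pgroup sylP) Px.
have prYG : (L <*> P)%G \proper G.
  rewrite properE join_subG normal_sub //= sPG; apply: contra not_sKL => sGY.
  have nLP : P \subset 'N(L) := subset_trans sPG (normal_norm nsLG).
  rewrite /= norm_joinEr // in sGY.
  rewrite -{1}(setIidPl (subset_trans sKG sGY)) setIC -group_modl // mul_subG //.
have [BY basisY] := proper_basis _ prYG.
have [BL basisL] : exists B : seq 'CF(L), pbasis p B.
  by apply: proper_basis; apply: sub_proper_trans prYG; apply: joing_subl.
exact (induced_basis nsLG nsKG sLK p'KL sylP defG sPKL basisL basisY proper_basis prYG).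
Qed.

End Existence.
Local Open Scope group_scope.
Local Open Scope ring_scope.

(** * Fusion-invariant characters *)

(** The forms [ev i] are required to commute with sums over ordinals only, so that
    evaluation and inner products can be used without bundling them. *)
Lemma free_map_dual (vT : vectType algC) (I : eqType) (s : seq I) (f : I -> vT)
    (ev : I -> vT -> algC) :
    uniq s ->
    (forall i n (k : 'I_n -> algC) g,
       ev i (\sum_j k j *: g j) = \sum_j k j * ev i (g j)) ->
    {in s &, forall i j, ev i (f j) = (i == j)%:R} ->
  free (map f s).
Proof.
case: s => [|i0 s'] => [_ _ _|]; first exact: nil_free.
set s := i0 :: s' => us ev_lin ev_f.
apply/(@freeP _ _ _ (map_tuple f (in_tuple s))) => k k0 i.
have lt_j (j : 'I_(size s)) : nth i0 s j \in s by apply: mem_nth.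
have E0 (j : 'I_(size s)) : (map_tuple f (in_tuple s))`_j = f (nth i0 s j).
  exact: (nth_map i0 (0 : vT) f (ltn_ord j)).
have ev0 t : ev t 0 = 0.
  by have := ev_lin t 0%N (fun _ => 0) (fun _ => 0); rewrite !big_ord0.
have {}k0 : \sum_(j < size s) k j *: f (nth i0 s j) = 0.
  by rewrite -[RHS]k0; apply: eq_bigr => j _; rewrite E0.
have := ev_lin (nth i0 s i) _ k (fun j => f (nth i0 s j)).
rewrite k0 ev0 (bigD1 i) //= big1 => [|j neq_ji].
  by rewrite addr0 ev_f // eqxx mulr1.
rewrite ev_f // nth_uniq // [_ == _](_ : _ = false) ?mulr0 //.
by apply: contraNF neq_ji; rewrite eq_sym.
Qed.

Section FusionInvariant.

Variables (gT : finGroupType) (G P : {group gT}).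
Hypothesis sPG : P \subset G.

Local Notation F := (fusion_system G P).
Local Notation fconj := (fusion_conj P F).

Lemma fusion_conjE x y : x \in P -> y \in P -> fconj x y = (y \in x ^: G)%g.
Proof.
move=> Px Py; apply/existsP/imsetP => [[f /andP[]] | [g Gg Dy]].
  rewrite inE => /and3P[_ _ /exists_inP[g Gg /andP[_ /forallP Df]]] /eqP Dy.
  exists g => //; rewrite -Dy (eqP (Df _)) subgK //; exact: cycle_id.
have sxP : <[x]>%g \subset P by rewrite cycle_subG.
have sxgP : <[x]>%g :^ g \subset P by rewrite -cycleJ cycle_subG -Dy.
pose f := [ffun u : subg_of <[x]>%G => subg P (sgval u ^ g)%g].
have fE u : sgval (f u) = (sgval u ^ g)%g.
  rewrite ffunE subgK //; apply: (subsetP sxgP); rewrite memJ_conjg.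
  exact: subgP.
exists f; apply/andP; split; last by rewrite fE subgK ?cycle_id // -Dy.
rewrite inE sxP subxx /=; apply/exists_inP; exists g => //; rewrite sxgP.
by apply/forallP=> u; rewrite fE.
Qed.

Lemma fusion_invariantP (f : 'CF(P)) :
  fusion_invariant F f <-> {in P &, forall x y, y \in (x ^: G)%g -> f x = f y}.
Proof.
by split=> Ff x y Px Py; have := Ff x y Px Py; rewrite fusion_conjE.
Qed.

Lemma fusion_invariant_Res (h : 'CF(G)) : fusion_invariant F ('Res[P] h).
Proof.
apply/fusion_invariantP => x y Px Py /imsetP[g Gg Dy].
by rewrite !cfResE // Dy cfunJ.
Qed.

Lemma class_cfuniE x y : x \in G ->
  ('1_(x ^: G) : 'CF(G)) y = (y \in x ^: G)%g%:R.
Proof.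
move=> Gx; rewrite cfuniE // /normal class_norm andbT; exact: class_subG.
Qed.

(** The lift vanishes on the classes of [G] that do not meet [P]; its value on the
    others is read off at any common element. *)
Lemma fusion_invariant_lift (f : 'CF(P)) :
  fusion_invariant F f -> exists h : 'CF(G), f = 'Res[P] h.
Proof.
move/fusion_invariantP=> Ff.
exists (\sum_(C in classes G) f (repr (P :&: C)) *: '1_C).
apply/cfun_inP=> x Px; have Gx := subsetP sPG x Px; rewrite cfResE // sum_cfunE.
rewrite (bigD1 (x ^: G)%g) ?mem_classes //= big1 => [|C].
  rewrite addr0 cfunE class_cfuniE // class_refl mulr1.
  have /setIP[Pr Cr] : repr (P :&: x ^: G)%g \in P :&: x ^: G.
    by apply: (mem_repr x); rewrite inE Px class_refl.
  exact: Ff.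
case/andP=> /imsetP[z Gz ->] neq; rewrite cfunE class_cfuniE //.
by case: class_eqP => [eq_xz | _]; [rewrite eq_xz eqxx in neq | rewrite mulr0].
Qed.

Let fclass x := [set y in P | fconj x y].

Let fclassE x : x \in P -> fclass x = P :&: x ^: G.
Proof.
by move=> Px; apply/setP=> y; rewrite !inE; apply: andb_id2l => /(fusion_conjE Px).
Qed.

Let fclass_normal x : x \in P -> fclass x <| P.
Proof.
move=> Px; rewrite fclassE // /normal subsetIl normsI ?normG //.
exact: subset_trans sPG (class_norm x G).
Qed.

Let fclass_eq x z : x \in P -> z \in P -> z \in fclass x -> fclass z = fclass x.
Proof.
move=> Px Pz; rewrite !fclassE // inE Pz /= => /class_eqP->.
by [].
Qed.

(** The number of fusion classes is the dimension of the space of invariant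
    class functions, which has the class indicators as a basis. *)
Lemma fusion_class_number_dim (S : seq 'CF(P)) :
    free S -> (forall f, f \in <<S>>%VS <-> fusion_invariant F f) ->
  size S = fusion_class_number P F.
Proof.
move=> frS spanS; set cls := enum (equivalence_partition fconj P).
have clsP c : c \in cls -> exists2 x, x \in P & c = fclass x.
  by rewrite mem_enum => /imsetP[x Px ->]; exists x.
have cls_mem x : x \in P -> fclass x \in cls.
  by move=> Px; rewrite mem_enum; apply: imset_f.
have oneE c x : c \in cls -> x \in P -> ('1_c : 'CF(P)) x = (x \in c)%:R.
  by case/clsP=> z Pz -> Px; rewrite cfuniE ?fclass_normal.
have in_fclass x : x \in P -> x \in fclass x.
  by move=> Px; rewrite fclassE // inE Px class_refl.
have reprP c : c \in cls -> repr c \in P /\ c = fclass (repr c).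
  case/clsP=> x Px ->; have r_in := mem_repr x (in_fclass x Px).
  have Pr : repr (fclass x) \in P by move: r_in; rewrite inE => /andP[].
  by split=> //; rewrite [RHS](fclass_eq Px).
have mem_cls c x : c \in cls -> x \in P -> (x \in c) = (c == fclass x).
  case/clsP=> z Pz -> Px; apply/idP/eqP => [|->]; last exact: in_fclass.
  by move/(fclass_eq Pz Px).
pose D := [seq ('1_c : 'CF(P)) | c <- cls].
have frD : free D.
  pose ev (c : {set gT}) (v : 'CF(P)) := v (repr c).
  apply: (free_map_dual (f := fun c => '1_c : 'CF(P)) (ev := ev)); first exact: enum_uniq.
    by move=> c n k g; rewrite /ev sum_cfunE; apply: eq_bigr => j _; rewrite cfunE.
  move=> c c' cls_c cls_c'; rewrite /ev; have [Pr Dc] := reprP c cls_c.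
  by rewrite oneE // mem_cls // -Dc eq_sym.
have spanD f : f \in <<D>>%VS <-> fusion_invariant F f.
  split=> [Df | /fusion_invariantP Ff].
    apply/fusion_invariantP=> x y Px Py xGy.
    rewrite (coef_expand_span frD Df) !sum_cfunE big_seq [RHS]big_seq.
    have Dxy : fclass y = fclass x.
      by apply: fclass_eq; rewrite // fclassE // inE Py.
    apply: eq_bigr => _ /mapP[c cls_c ->]; rewrite cfunE [RHS]cfunE.
    by rewrite (oneE c x) // (oneE c y) // (mem_cls c x) // (mem_cls c y) // Dxy.
  have ->: f = \sum_(c <- cls) f (repr c) *: '1_c.
    apply/cfun_inP=> x Px; rewrite sum_cfunE.
    rewrite (bigD1_seq (fclass x)) ?cls_mem ?enum_uniq //= big_seq_cond big1 => [|c].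
      rewrite addr0 cfunE oneE ?cls_mem // in_fclass // mulr1.
      have /setIP[Pr xGr] : repr (fclass x) \in P :&: x ^: G.
        by rewrite -fclassE //; apply: mem_repr (in_fclass x Px).
      exact: Ff.
    by case/andP=> cls_c neq; rewrite cfunE oneE // mem_cls // (negPf neq) mulr0.
  by rewrite big_seq memv_suml // => c cls_c; rewrite memvZ ?memv_span ?map_f.
have eqSD : <<S>>%VS = <<D>>%VS.
  by apply/vspaceP=> f; apply/idP/idP => [/spanS/spanD | /spanD/spanS].
rewrite /fusion_class_number -(eqP frS) eqSD (eqP frD) size_map /cls.
by rewrite -cardE.
Qed.

End FusionInvariant.

(** * The dual basis *)

Section DualBasis.

Variables (p : nat) (gT : finGroupType) (G P : {group gT}) (B : seq 'CF(G)).
Hypotheses (sylP : p.-Sylow(G) P) (basisB : pbasis p B).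

Local Notation F := (fusion_system G P).
Let sPG := pHall_sub sylP.
Let frB : free B := pbasis_free basisB.

(** Such an irreducible character of [P] plays the role of a Fong character. *)
Lemma pbasis_irr b : b \in B -> exists i, b = 'Ind[G] 'chi[P]_i.
Proof.
move=> Bb; have [b_p nz_b ind_b] :=
  (nat_basis_mem basisB (p_induced_zero p G) (@p_inducedD gT p G) b).1 Bb.
have [beta Nbeta Db] := p_induced_Sylow sylP b_p.
have nz_beta : beta != 0 by apply: contraNneq nz_b => beta0; rewrite Db beta0 linear0.
have [i] := neq0_has_constt nz_beta; case/(constt_charP _ Nbeta)=> psi Npsi Dbeta.
exists i; rewrite Dbeta linearD /= in Db.
have pP := pHall_pgroup sylP.
have Ichi_p := p_induced_Ind_char sPG pP (irr_char i).
have Ipsi_p := p_induced_Ind_char sPG pP Npsi.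
have [] := ind_b _ _ Ichi_p Ipsi_p Db.
  move/cfunP/(_ 1%g)/eqP; rewrite cfInd1 // cfunE mulf_eq0 (negPf (irr1_neq0 i)).
  by rewrite orbF pnatr_eq0 eqn0Ngt indexg_gt0.
by move=> psi0; rewrite Db psi0 addr0.
Qed.

Definition fong_index b : Iirr P := odflt 0 [pick i | b == 'Ind[G] 'chi[P]_i].

Lemma Ind_fong b : b \in B -> 'Ind[G] 'chi_(fong_index b) = b.
Proof.
case/pbasis_irr=> i Db; rewrite /fong_index; case: pickP => [j /eqP <- // | /(_ i)].
by rewrite -Db eqxx.
Qed.

(** The class function of [G] that represents the linear form [coef B b]. *)
Definition dual_lift b : 'CF(G) := \sum_j (coef B b 'chi_j)^* *: 'chi_j.
Definition dual_char b : 'CF(P) := 'Res[P] (dual_lift b).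

Lemma cfdot_dual_lift b Theta : '[Theta, dual_lift b] = coef B b Theta.
Proof.
rewrite cfdot_sumr [in RHS](cfun_sum_cfdot Theta) coef_big; apply: eq_bigr => j _.
by rewrite cfdotZr conjCK coefZ mulrC.
Qed.

Lemma cfdot_dual_char b beta : '[beta, dual_char b] = coef B b ('Ind[G] beta).
Proof. by rewrite Frobenius_reciprocity cfdot_dual_lift. Qed.

Lemma dual_char_char b : dual_char b \is a character.
Proof.
rewrite (cfun_sum_cfdot (dual_char b)); apply: rpred_sum => i _.
rewrite cfdotC cfdot_dual_char.
have /natrP[n ->] : coef B b ('Ind[G] 'chi_i) \in Num.nat.
  by apply: (pbasis_nat basisB); apply: p_induced_Ind_char (pHall_pgroup sylP) (irr_char i).
by rewrite conjC_nat rpredZ_nat ?irr_char.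
Qed.

(** Both sides have the same inner product with every irreducible character of
    [P]: by Frobenius reciprocity it depends on the induced character alone, which
    expands in [B]. *)
Lemma dual_char_expand f : fusion_invariant F f ->
  f = \sum_(b <- B) '[f, 'chi_(fong_index b)] *: dual_char b.
Proof.
case/(fusion_invariant_lift sPG)=> h Df; have pP := pHall_pgroup sylP.
rewrite [LHS]cfun_sum_cfdot [RHS]cfun_sum_cfdot; apply: eq_bigr => i _.
congr (_ *: _); rewrite [LHS]cfdotC [RHS]cfdotC; congr (_^*).
have Ii_p : p_induced p ('Ind[G] 'chi[P]_i) by apply: p_induced_Ind_char (irr_char i).
rewrite {1}Df Frobenius_reciprocity (pbasis_expand basisB Ii_p).
rewrite cfdot_suml cfdot_sumr big_seq [RHS]big_seq; apply: eq_bigr => b Bb.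
rewrite cfdotZl cfdotZr cfdot_dual_char mulrC -cfdotC Df Frobenius_reciprocity.
by rewrite Ind_fong.
Qed.

Lemma dual_char_fong : {in B &, forall b b',
  '[dual_char b', 'chi_(fong_index b)] = (b == b')%:R}.
Proof.
move=> b b' Bb Bb'; rewrite cfdotC cfdot_dual_char Ind_fong // coef_id //.
by rewrite conjC_nat.
Qed.

Lemma dual_free : free (map dual_char B).
Proof.
apply: (free_map_dual (ev := fun b v => '[v, 'chi_(fong_index b)])).
- exact: free_uniq.
- by move=> b n k g; rewrite cfdot_suml; apply: eq_bigr => j _; rewrite cfdotZl.
exact: dual_char_fong.
Qed.

Definition invariant_char (chi : 'CF(P)) :=
  chi \is a character /\ fusion_invariant F chi.

Lemma fusion_invariantD (f g : 'CF(P)) :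
  fusion_invariant F f -> fusion_invariant F g -> fusion_invariant F (f + g).
Proof. by move=> Ff Fg x y Px Py xy; rewrite !cfunE (Ff x y) ?(Fg x y). Qed.

Lemma invariant_char_basis : nat_basis invariant_char (map dual_char B).
Proof.
split=> [|_ /mapP[b _ ->] | chi [Nchi Fchi]]; first exact: dual_free.
  by split; [apply: dual_char_char | apply: fusion_invariant_Res].
rewrite (dual_char_expand Fchi); apply: nat_span_sum => b Bb _.
have /natrP[n ->] : '[chi, 'chi_(fong_index b)] \in Num.nat.
  exact: Cnat_cfdot_char_irr.
rewrite scaler_nat; apply/nat_spanMn/nat_span_mem/map_f => //.
exact: free_uniq dual_free.
Qed.

Lemma fusion_indecomposableP chi :
  fusion_indecomposable F chi <-> indecomposable invariant_char chi.
Proof.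
split=> [[[Nchi nz_chi Fchi] ind_chi] | [[Nchi Fchi] nz_chi ind_chi]].
  split=> // v w [Nv Fv] [Nw Fw] Dchi.
  have [-> | nz_v] := eqVneq v 0; first by left.
  have [-> | nz_w] := eqVneq w 0; first by right.
  by case: ind_chi; exists v, w.
split=> // [[v [w [[Nv nz_v Fv] [Nw nz_w Fw] Dchi]]]].
by have [] := ind_chi v w (conj Nv Fv) (conj Nw Fw) Dchi; apply/eqP.
Qed.

Lemma dual_span (f : 'CF(P)) : f \in <<map dual_char B>>%VS <-> fusion_invariant F f.
Proof.
split=> [span_f | Ff].
  apply/fusion_invariantP => x y Px Py xGy.
  rewrite (coef_expand_span dual_free span_f) !sum_cfunE big_seq [RHS]big_seq.
  apply: eq_bigr => _ /mapP[b _ ->]; rewrite !cfunE; congr (_ * _).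
  exact: (fusion_invariantP _ _).1 (fusion_invariant_Res sPG _) x y Px Py xGy.
rewrite (dual_char_expand Ff) big_seq memv_suml // => b Bb.
by rewrite memvZ ?memv_span ?map_f.
Qed.

End DualBasis.

Local Open Scope group_scope.

Theorem theorem2 (p : nat) (gT : finGroupType) (G P : {group gT})
    (p_prime : prime p) (solG : p_solvable p G) (sylP : p.-Sylow(G) P) :
  exists Ind : seq 'CF(P),
    [/\ uniq Ind,
        forall chi : 'CF(P),
          chi \in Ind <-> fusion_indecomposable (fusion_system G P) chi
      & size Ind = fusion_class_number P (fusion_system G P)].
Proof.
have [B basisB] := p_separable_basis (p_solvable_separable solG).
have sPG := pHall_sub sylP; have basisD := invariant_char_basis sylP basisB.
exists (map (dual_char P B) B); split.
- exact: free_uniq (dual_free sylP basisB).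
- move=> chi; apply: iff_trans (iff_sym (fusion_indecomposableP G chi)).
  apply: (nat_basis_mem basisD).
    by split; [apply: cfun0_char | move=> x y; rewrite !cfunE].
  move=> u v [Nu Fu] [Nv Fv]; split; first exact: rpredD.
  exact: fusion_invariantD.
exact: (fusion_class_number_dim sPG (dual_free sylP basisB) (dual_span sylP basisB)).
Qed.
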